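(* Let $H=(V,E)$ be a hypergraph, $b\in\mathbb{Z}^V_{\geq 1}$, $w\in\mathbb{R}^E_{\geq 0}$, and let $x\in[0,1]^E$ be a fractional $b$-matching. Then there is an efficient (polynomial-time) randomized sampling procedure returning a $b$-matching $M$ that satisfies \[ \Pr[e\in M]\geq \frac{x(e)}{|e|-(|e|-1)x(e)}\quad\text{for all } e\in E. \]
   Context: A hypergraph $H=(V,E)$ has a finite vertex set $V$ and edge set $E\subseteq 2^V$. For $v\in V$, $\delta(v)=\{e\in E: v\in e\}$, and for $x\in\mathbb{R}^E$ and $U\subseteq E$, $x(U)=\sum_{e\in U}x(e)$. Given $b\in\mathbb{Z}^V_{\ge 1}$, a $b$-matching is a set $M\subseteq E$ such that each $v\in V$ lies in at most $b(v)$ edges of $M$. A fractional $b$-matching is a vector $x\in[0,1]^E$ with $x(\delta(v))\le b(v)$ for all $v\in V$. *)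

(* Defs.v *)
From mathcomp Require Import all_boot all_order all_algebra.
From mathcomp Require Import all_classical all_reals all_analysis.

Set Implicit Arguments.
Unset Strict Implicit.
Unset Printing Implicit Defensive.

Import Order.TTheory GRing.Theory Num.Theory.
Import numFieldNormedType.Exports.

Local Open Scope classical_set_scope.
Local Open Scope ring_scope.

(* A hypergraph is a finite type V of vertices with an edge set
   E : {set {set V}}.  Vectors indexed by E are functions on {set V}, of which
   only the values on E are ever used. *)

Definition delta (V : finType) (E : {set {set V}}) (v : V) : {set {set V}} :=
  [set e in E | v \in e]%SET.

Definition is_bmatching (V : finType) (E : {set {set V}}) (b : V -> nat)
    (M : {set {set V}}) : Prop :=
  M \subset E /\ forall v : V, (#|M :&: delta E v| <= b v)%N.

Definition is_fractional_bmatching (R : realType) (V : finType)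
    (E : {set {set V}}) (b : V -> nat) (x : {set V} -> R) : Prop :=
  (forall e, e \in E -> 0 <= x e <= 1) /\
  (forall v : V, \sum_(e in delta E v) x e <= (b v)%:R).

(* Randomized algorithms on real data are programs of a real RAM
   (Preparata & Shamos, "Computational Geometry", Section 1.4): a random access
   machine with a memory of integers and a memory of exact reals, both
   indirectly addressable, unit-cost operations, and the additional ability to
   draw independent uniform reals from [0,1].  The operations are chosen so that
   unit cost is not abusive: integers have no multiplication, and there is no
   way of going from reals to integers (no floor) other than branching on a
   comparison.  No real constant other than integers occurs in a program. *)

Inductive nexp : Type :=
  | NConst of nat
  | NLoad of nexp
  | NAdd of nexp & nexp
  | NSub of nexp & nexp.

Inductive rexp : Type :=
  | RNat of nexp
  | RLoad of nexp
  | RAdd of rexp & rexp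
  | RSub of rexp & rexp
  | RMul of rexp & rexp
  | RDiv of rexp & rexp
  | RExp of rexp
  | RLn of rexp.

Inductive bexp : Type :=
  | BLeN of nexp & nexp
  | BLeR of rexp & rexp
  | BNot of bexp
  | BAnd of bexp & bexp.

Inductive cmd : Type :=
  | Skip
  | SetN of nexp & nexp
  | SetR of nexp & rexp
  | RandR of nexp
  | Seq of cmd & cmd
  | If of bexp & cmd & cmd
  | While of bexp & cmd.

Section Semantics.
Variable R : realType.

Record state : Type := State { nmem : nat -> nat; rmem : nat -> R }.

Definition update (T : Type) (f : nat -> T) (a : nat) (y : T) : nat -> T :=
  fun i => if i == a then y else f i.

(* Subtraction is truncated. *)
Fixpoint neval (s : state) (e : nexp) : nat :=
  match e with
  | NConst n => n
  | NLoad a => nmem s (neval s a)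
  | NAdd e1 e2 => (neval s e1 + neval s e2)%N
  | NSub e1 e2 => (neval s e1 - neval s e2)%N
  end.

(* Division by 0 and the logarithm of a nonpositive number return 0. *)
Fixpoint reval (s : state) (e : rexp) : R :=
  match e with
  | RNat n => (neval s n)%:R
  | RLoad a => rmem s (neval s a)
  | RAdd e1 e2 => reval s e1 + reval s e2
  | RSub e1 e2 => reval s e1 - reval s e2
  | RMul e1 e2 => reval s e1 * reval s e2
  | RDiv e1 e2 => reval s e1 / reval s e2
  | RExp e1 => expR (reval s e1)
  | RLn e1 => ln (reval s e1)
  end.

Fixpoint beval (s : state) (e : bexp) : bool :=
  match e with
  | BLeN e1 e2 => (neval s e1 <= neval s e2)%N
  | BLeR e1 e2 => reval s e1 <= reval s e2
  | BNot e1 => ~~ beval s e1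
  | BAnd e1 e2 => beval s e1 && beval s e2
  end.

(* The stack of commands still to be executed, and the memory. *)
Definition config : Type := (seq cmd * state)%type.

(* One step of computation.  The argument u is a random number reserved for
   this step; it is used only if the step executes a RandR command.  As the
   expressions of a fixed program have bounded size, counting steps and counting
   unit-cost operations agree up to a constant factor. *)
Definition step (c : config) (u : R) : config :=
  let: (k, s) := c in
  match k with
  | [::] => c
  | Skip :: k' => (k', s)
  | SetN a e :: k' =>
      (k', State (update (nmem s) (neval s a) (neval s e)) (rmem s))
  | SetR a e :: k' =>
      (k', State (nmem s) (update (rmem s) (neval s a) (reval s e)))
  | RandR a :: k' =>
      (k', State (nmem s) (update (rmem s) (neval s a) u))
  | Seq c1 c2 :: k' => (c1 :: c2 :: k', s)
  | If e c1 c2 :: k' => ((if beval s e then c1 else c2) :: k', s)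
  | While e c1 :: k' =>
      if beval s e then (c1 :: While e c1 :: k', s) else (k', s)
  end.

(* The configuration after size t steps, t being the tape of random numbers. *)
Definition run (A : cmd) (s : state) (t : seq R) : config :=
  foldl step ([:: A], s) t.

Definition halted (c : config) : bool := nilp c.1.

(* The law of n independent uniform random variables on [0,1], that is, the
   n-fold product of the Lebesgue measure of [0,1], as an iterated integral. *)
Fixpoint tape_prob (n : nat) : set (n.-tuple R) -> \bar R :=
  match n return set (n.-tuple R) -> \bar R with
  | 0%N => fun X => (\1_X [tuple])%:E
  | n'.+1 => fun X =>
      (\int[lebesgue_measure]_(u in `[0%R, 1%R])
         tape_prob [set t : n'.-tuple R | X [tuple of u :: t]])%E
  end.

Section Encoding.
Variables (V : finType) (E : {set {set V}}).

(* Integer memory: |V|, |E|, the incidence matrix row by row (one row per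
   vertex), then b.  Real memory: x, then w.  All other cells contain 0. *)
Definition encode (b : V -> nat) (w x : {set V} -> R) : state :=
  State
    (nth 0%N ([:: #|V|; #|E|] ++
              [seq nat_of_bool (v \in e) | v : V <- enum V, e : {set V} <- enum E] ++
              [seq b v | v <- enum V]))
    (nth 0 ([seq x e | e <- enum E] ++ [seq w e | e <- enum E])).

(* The returned set is read off the first |E| integer cells. *)
Definition output (c : config) : {set {set V}} :=
  [set e in E | nmem c.2 (index e (enum E)) != 0%N]%SET.

End Encoding.
End Semantics.

(* Main.v *)
Require Import Defs.
From mathcomp Require Import all_boot all_order all_algebra.
From mathcomp Require Import all_classical all_reals all_analysis.
From mathcomp Require Import measurable_realfun zify ring lra.

Import Order.TTheory GRing.Theory Num.Theory.
Import numFieldNormedType.Exports.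

Set Implicit Arguments.
Unset Strict Implicit.
Unset Printing Implicit Defensive.

Local Open Scope classical_set_scope.
Local Open Scope ring_scope.

(* Greedy selection in an adaptively randomized order.  Let M be the set of
   edges selected so far and c_v = b_v - |M :&: delta v|.  Each vertex carries a
   multiplier mu_v in [0,1], initially 1, such that the edges f outside M satisfy
     sum_(f in delta v) x_f mu_v <= c_v.
   When e is selected, every v in e replaces mu_v by
   mu_v (c_v - 1) / (c_v - x_e mu_v), which keeps this inequality true, and
   mu_v = 0 as soon as c_v = 0.  For an undecided edge f put
     phi_f = x_f (1 - sum_(v in f) (1 - mu_v)),
   and g_f = |f| (1 - x_f) + x_f.  Initially phi_f = x_f, and phi_f <= 0 when f
   becomes blocked, so P[f in M] >= x_f / g_f follows if phi_f, replaced by g_f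
   once f is selected, never decreases in expectation.

   Selecting e costs the other edges a total of
     sum_(f != e) sum_(v in e :&: f) x_f mu_v (1 - x_e mu_v) / (c_v - x_e mu_v)
       <= sum_(v in e) (1 - x_e mu_v),
   and the right-hand side is exactly the gain g_e - phi_e of e.  So the matrix
   of changes has nonnegative off-diagonal entries and nonpositive row sums, as
   the generator of a Markov chain, and a stationary distribution, found by
   Gaussian elimination, is a law for the next edge under which no phi_f
   decreases in expectation. *)

(** * Solving the balance equations *)

(** The term 1 - mu_v is a penalty charged separately at each vertex of f, as in a union bound. This
    makes [phi] affine in the multipliers, so the effect of a selection is a sum over shared
    vertices and fits into a matrix. It is also where the bound comes from: initially the gain of e
    is |e| (1 - x_e), and adding phi_e = x_e gives g_e = |e| - (|e| - 1) x_e, the denominator of the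
    statement. Two obstacles shape the rest. First, the law of the next edge must be computed by a
    fixed program with field operations, so elimination runs in a fixed order without searching for
    pivots; the sign pattern, which it preserves, is what makes this safe. An inequality p A <= 0 is
    enough, so blocked and selected edges can be kept as zero rows and columns. Second, the law of
    the tape is an iterated integral of functions whose measurability is never established.
    Probabilities are therefore only bounded from below, by step functions of the number drawn in
    the current round. *)

Section Elimination.
Variables (R : realFieldType) (n : nat) (act : pred nat).
Implicit Types (A B : nat -> nat -> R) (p : nat -> R).

(** Row and column t are left in place, so the final matrix still holds each pivot row and column as
    it was when used. A zero pivot makes the quotient 0, which is harmless here because its row
    vanishes too. *)
Definition elim t A : nat -> nat -> R :=
  fun i j => if (t < i)%N && (t < j)%N then A i j - A i t * A t j / A t t
             else A i j.

Fixpoint gauss t A := if t is t'.+1 then elim t' (gauss t' A) else A.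

(* At a zero pivot the row of m vanishes, so the solution is restarted from
   state m; it is also started at the first active state that is met. *)
Definition bstep A m p : nat -> R :=
  if act m && ((0 <= A m m) || (\sum_(0 <= i < n) p i <= 0))
  then fun i => (i == m)%:R
  else fun i => if i == m then 0 - (\sum_(0 <= i < n) p i * A i m) / A m m
                else p i.

Fixpoint bsub A k : nat -> R :=
  if k is k'.+1 then bstep A (n - k) (bsub A k') else fun=> 0.

Lemma gauss_frozen A t T i j : (t <= T)%N -> (i <= t)%N || (j <= t)%N ->
  gauss T A i j = gauss t A i j.
Proof.
move=> /subnKC <-; elim: (T - t)%N => [|d IH] h; first by rewrite addn0.
by rewrite addnS /= /elim ifF; [exact: IH|apply/negbTE; lia].
Qed.

Variable A : nat -> nat -> R.
Hypothesis A_ge0 : forall i j, (i < n)%N -> (j < n)%N -> i != j -> 0 <= A i j.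
Hypothesis A_sum : forall i, (i < n)%N -> \sum_(0 <= j < n) A i j <= 0.
Hypothesis A_act : forall i j, ~~ act i || ~~ act j -> A i j = 0.

(** Generator of a Markov chain on the states t, .., n - 1; a negative row sum is a rate of
    killing. *)
Definition subgen t (B : nat -> nat -> R) :=
  [/\ forall i j, (t <= i < n)%N -> (t <= j < n)%N -> i != j -> 0 <= B i j,
      forall i, (t <= i < n)%N -> \sum_(t <= j < n) B i j <= 0
    & forall i j, ~~ act i || ~~ act j -> B i j = 0].

Lemma subgen_pivot t B : subgen t B -> (t < n)%N -> B t t <= 0.
Proof.
move=> [h1 h2 _] tn; have := h2 t; rewrite leqnn tn => /(_ isT).
rewrite big_ltn // => h; apply: le_trans h; rewrite lerDl.
by rewrite big_nat; apply: sumr_ge0 => j hj; apply: h1; lia.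
Qed.

(** The other entries of row t are nonnegative and add up to at most the negated pivot. *)
Lemma subgen_pivot0 t B j : subgen t B -> (t < j < n)%N -> B t t = 0 -> B t j = 0.
Proof.
move=> [h1 h2 _] jn B0; have := h2 t; rewrite leqnn (ltn_trans _ (proj2 (andP jn))) //; last lia.
move=> /(_ isT); rewrite big_ltn; last lia.
rewrite B0 add0r => h.
have h0 : 0 <= B t j by apply: h1; lia.
apply/eqP; rewrite eq_le h0 andbT; apply: le_trans h.
rewrite (big_cat_nat (n := j)) //=; [|lia|lia].
rewrite (big_ltn (m := j)); last lia.
rewrite addrCA lerDl addr_ge0 // big_nat; apply: sumr_ge0 => l hl; apply: h1; lia.
Qed.

(** This is the chain watched only outside state t: the rate B i t is redistributed in proportion to
    row t. The redistributed amount is at most B i t because row t has nonpositive sum, so row sums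
    do not become positive. *)
Lemma subgen_elim t B : subgen t B -> (t < n)%N -> subgen t.+1 (elim t B).
Proof.
move=> hB tn; have [h1 h2 h3] := hB; have piv := subgen_pivot hB tn.
split.
- move=> i j hi hj ij; rewrite /elim ifT; last lia.
  rewrite -mulrA subr_ge0; apply: (@le_trans _ _ 0); last by apply: h1; lia.
  apply: mulr_ge0_le0; first by apply: h1; lia.
  by apply: mulr_ge0_le0; [apply: h1; lia|rewrite invr_le0].
- move=> i hi.
  have -> : \sum_(t.+1 <= j < n) elim t B i j =
      \sum_(t.+1 <= j < n) B i j - B i t / B t t * \sum_(t.+1 <= j < n) B t j.
    rewrite mulr_sumr -sumrB; apply: eq_big_nat => j hj.
    by rewrite /elim ifT; [ring|lia].
  have := h2 i; rewrite big_ltn // => h2i.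
  have {h2i} : B i t + \sum_(t.+1 <= j < n) B i j <= 0 by apply: h2i; lia.
  have := h2 t; rewrite big_ltn // leqnn tn => /(_ isT).
  have : 0 <= B i t by apply: h1; lia.
  have [->|nz] := eqVneq (B t t) 0; first by rewrite invr0 mulr0 mul0r; lra.
  have neg : B t t < 0 by rewrite lt_neqAle nz.
  set s := \sum_(_ <= _ < _) B t _; set r := \sum_(_ <= _ < _) B i _ => b0 hs hr.
  apply: le_trans hr; rewrite [X in _ <= X]addrC lerD2l -mulrA -mulrN ler_piMr //.
  by rewrite -mulNr -invrN mulrC ler_pdivrMr ?oppr_gt0 //; lra.
- move=> i j hij; rewrite /elim h3 //; case: ifP => // _.
  by case/orP: hij => hij; rewrite sub0r; [rewrite (h3 i t)|rewrite (h3 t j)];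
     rewrite ?hij ?orbT // ?mul0r ?mulr0 ?mul0r oppr0.
Qed.

Lemma subgen_gauss t : (t <= n)%N -> subgen t (gauss t A).
Proof.
elim: t => [_|t IH tn]; last by apply: subgen_elim => //; apply: IH; lia.
by split=> [i j ? ?|i ?|]; [exact: A_ge0|exact: A_sum|exact: A_act].
Qed.

Definition prob := bsub (gauss n A) n.

Lemma sum_delta (f : nat -> R) m : (m < n)%N ->
  \sum_(0 <= i < n) (i == m)%:R * f i = f m.
Proof.
move=> mn; rewrite (big_cat_nat (n := m)) //=; last lia.
rewrite (big_ltn (m := m)) // eqxx mul1r.
rewrite big_nat big1 => [|i hi]; last by rewrite (_ : i == m = false) ?mul0r //; lia.
rewrite big_nat big1 => [|i hi]; last by rewrite (_ : i == m = false) ?mul0r //; lia.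
by rewrite add0r addr0.
Qed.

Lemma sum_set (f g : nat -> R) m y : (m < n)%N -> f m = 0 ->
  \sum_(0 <= i < n) (if i == m then y else f i) * g i =
  \sum_(0 <= i < n) f i * g i + y * g m.
Proof.
move=> mn fm; rewrite -(sum_delta (fun i => y * g i) mn) -big_split /=.
apply: eq_bigr => i _; case: eqP => [->|_]; first by rewrite fm mul0r add0r mul1r.
by rewrite !mul0r addr0.
Qed.

(** Invariant of back substitution: p is substationary for the Schur complement left after
    eliminating the states below m. The mass given to m balances column m exactly and turns the
    columns beyond m of the complement at m.+1 into those at m; it is nonnegative because pivots are
    nonpositive. The last clause excludes the zero solution. *)
Lemma bsubP k : (k <= n)%N -> let p := bsub (gauss n A) k in let m := (n - k)%N in
  [/\ forall i, 0 <= p i,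
      forall i, ~~ act i || ~~ (m <= i < n)%N -> p i = 0,
      forall j, (m <= j < n)%N -> \sum_(0 <= i < n) p i * gauss m A i j <= 0
    & forall j, act j -> (m <= j < n)%N -> 0 < \sum_(0 <= i < n) p i].
Proof.
elim: k => [_|k IH kn] p m.
  by split=> // [j|j _]; rewrite /m; lia.
have := IH (ltnW kn); rewrite -/(bsub _ k) /=; set q := bsub _ k => -[q0 qs qA qp].
have Em : (n - k = m.+1)%N by rewrite /m; lia.
rewrite Em in qs qA qp.
have mn : (m < n)%N by rewrite /m; lia.
have := subgen_gauss (ltnW mn); set B := gauss m A => hB.
have [h1 h2 h3] := hB; have piv := subgen_pivot hB mn.
have Fm i : gauss n A i m = B i m by rewrite (@gauss_frozen A m) ?leqnn ?orbT // ltnW.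
(* The induction hypothesis with the elimination step expanded; rows up to m drop out because q
   vanishes there. *)
have qB j : (m < j < n)%N ->
    \sum_(0 <= i < n) q i * B i j - (\sum_(0 <= i < n) q i * B i m) * B m j / B m m <= 0.
  move=> hj; have /qA : (m.+1 <= j < n)%N by lia.
  rewrite /= -/B /elim !mulr_suml -sumrB; apply: le_trans; rewrite le_eqVlt; apply/orP; left.
  apply/eqP; apply: eq_big_nat => i hi; case: ifP => hm; first by ring.
  by rewrite qs; [ring|apply/orP; right; lia].
rewrite /p /= -/q -/m /bstep Fm.
have -> : \sum_(0 <= i < n) q i * gauss n A i m = \sum_(0 <= i < n) q i * B i m.
  by apply: eq_bigr => i _; rewrite Fm.
have Q0 : 0 <= \sum_(0 <= i < n) q i * B i m.
  rewrite big_nat; apply: sumr_ge0 => i hi; have [im|im] := leqP i m.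
    by rewrite qs ?mul0r //; apply/orP; right; lia.
  by apply: mulr_ge0; [|apply: h1; lia].
case: ifP => [/andP[am hm]|hm].
  split=> [i|i hi|j hj|j _ _].
  - by rewrite ler0n.
  - by case: eqP => // e; move: hi; rewrite e am leqnn mn.
  - rewrite sum_delta //; have [->//|jm] := eqVneq j m.
    have mj : (m < j < n)%N by lia.
    (* Unit mass at m is substationary: either the pivot is 0 and row m vanishes, or q has no mass,
       so no state beyond m is active and row m vanishes off the diagonal. *)
    case/orP: hm => hm; first by rewrite (subgen_pivot0 hB) //; apply: le_anti; rewrite piv hm.
    have [aj|aj] := boolP (act j); last by rewrite h3 ?aj ?orbT.
    by have := qp j aj; rewrite ltNge hm => /(_ _)/negP; case; lia.
  - under eq_bigr do rewrite -[(_ == m)%:R]mulr1.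
    by rewrite (sum_delta (fun=> 1)).
have qm : q m = 0 by apply: qs; rewrite ltnn orbT.
have [z|nz] := eqVneq (B m m) 0.
  (* An active m with zero pivot would have triggered the restart. For inactive m the column is zero
     and q is kept. *)
  have am : ~~ act m by apply/negP => am; rewrite am z lexx in hm.
  have Qz : \sum_(0 <= i < n) q i * B i m = 0.
    by rewrite big1 // => i _; rewrite h3 ?am ?orbT // mulr0.
  rewrite Qz mul0r subr0; have E i : (if i == m then 0 else q i) = q i.
    by case: eqP => // ->.
  split=> [i|i hi|j hj|j aj hj] /=.
  - by rewrite E.
  - rewrite E; have [->//|im] := eqVneq i m; apply: qs; case/orP: hi => [->//|hi].
    apply/orP; right; lia.
  - under eq_bigr do rewrite E.
    have [->|jm] := eqVneq j m; first by rewrite Qz.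
    by have := qB j; rewrite Qz !mul0r subr0; apply; lia.
  - under eq_bigr do rewrite E.
    by apply: (qp j) => //; have : j != m by [apply: contraNneq am => <-]; lia.
have neg : B m m < 0 by rewrite lt_neqAle nz.
set y := 0 - _; have y0 : 0 <= y.
  by rewrite /y sub0r -mulrN -invrN mulr_ge0 // invr_ge0 oppr_ge0.
have p0 i : 0 <= (if i == m then y else q i) by case: eqP.
split=> // [i hi|j hj|j aj hj].
- case: eqP => [e|/eqP ne].
    rewrite e leqnn mn orbF in hi.
    by rewrite (h3 m m) ?hi // eqxx in nz.
  apply: qs; case/orP: hi => [->//|hi]; apply/orP; right; lia.
- rewrite sum_set //; have [->|jm] := eqVneq j m.
    by rewrite le_eqVlt; apply/orP; left; apply/eqP; rewrite /y; field.
  have /qB : (m < j < n)%N by lia.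
  by apply: le_trans; rewrite le_eqVlt; apply/orP; left; apply/eqP; rewrite /y; ring.
- have [jm|jm] := eqVneq j m.
    move: hm; rewrite -jm aj /= => /negbT; rewrite negb_or -!ltNge => /andP[_ s0].
    apply: lt_le_trans s0 _; apply: ler_sum => i _; case: eqP => // ->.
    by rewrite jm qm.
  have s0 : 0 < \sum_(0 <= i < n) q i by apply: (qp j) => //; lia.
  apply: lt_le_trans s0 _; apply: ler_sum => i _; case: eqP => // ->.
  by rewrite qm.
Qed.

Lemma probP :
  [/\ forall i, 0 <= prob i,
      forall i, ~~ act i -> prob i = 0,
      forall j, (j < n)%N -> \sum_(0 <= i < n) prob i * A i j <= 0
    & forall j, act j -> (j < n)%N -> 0 < \sum_(0 <= i < n) prob i].
Proof.
have [] := bsubP (leqnn n); rewrite subnn => h1 h2 h3 h4.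
split=> [|i hi|j hj|j aj hj]; [exact: h1|by apply: h2; rewrite hi|exact: h3|exact: (h4 j)].
Qed.

End Elimination.

(** * One round of the sampling procedure *)

Section Round.
Variables (R : realFieldType) (n nv : nat) (inc : nat -> nat -> bool).
Variables (x : nat -> R) (b : nat -> nat).
Implicit Types (c sel : nat -> nat) (mu : nat -> R).

Definition active c sel e : bool :=
  [&& (e < n)%N, sel e == 0%N & all (fun v => inc v e ==> (0 < c v)%N) (iota 0 nv)].

Definition shrink (ce : nat) (m xe : R) : R := m * (ce%:R - 1) / (ce%:R - xe * m).

Definition acap c e v := if inc v e then (c v - 1)%N else c v.
Definition amul c mu e v := if inc v e then shrink (c v) (mu v) (x e) else mu v.
Definition asel sel e f := if f == e then 1%N else sel f.

(** Decrease of phi_f caused at v by selecting e. Off the diagonal it is x_f times the drop of the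
    multiplier, mu - mu (c - 1) / (c - x_e mu) = mu (1 - x_e mu) / (c - x_e mu); on the diagonal it
    is minus the share of v in the gain of e. *)
Definition flow c mu e f v : R :=
  if inc v e && inc v f then
    if e == f then - (1 - x e * mu v)
    else x f * mu v * (1 - x e * mu v) / ((c v)%:R - x e * mu v)
  else 0.

Definition flowmx c mu sel e f : R :=
  if active c sel e && active c sel f then \sum_(0 <= v < nv) flow c mu e f v
  else 0.

Definition load mu sel v e : R :=
  if inc v e && (sel e == 0%N) then x e * mu v else 0.

(** The second clause is a conservation law that yields feasibility, capacities being natural
    numbers. The fourth makes a blocked edge have deficit at least 1, hence phi <= 0. *)
Definition good c mu sel :=
  [/\ forall e, (e < n)%N -> (sel e <= 1)%N,
      forall v, (v < nv)%N -> (c v + \sum_(0 <= e < n) inc v e * sel e = b v)%N,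
      forall v, (v < nv)%N -> 0 <= mu v <= 1,
      forall v, (v < nv)%N -> c v = 0%N -> mu v = 0
    & forall v, (v < nv)%N -> \sum_(0 <= e < n) load mu sel v e <= (c v)%:R].

Hypothesis x01 : forall e, (e < n)%N -> 0 <= x e <= 1.

Lemma activeP c sel e v : active c sel e -> (v < nv)%N -> inc v e -> (0 < c v)%N.
Proof.
by case/and3P => _ _ /allP h hv iv; move: (h v); rewrite mem_iota hv iv; exact.
Qed.

Lemma load_ge0 c mu sel v e : good c mu sel -> (v < nv)%N -> (e < n)%N ->
  0 <= load mu sel v e.
Proof.
move=> [_ _ h3 _ _] hv he; rewrite /load; case: ifP => // _.
have := h3 v hv; have := x01 he => /andP[x0 _] /andP[m0 _]; exact: mulr_ge0.
Qed.

Lemma big_nat_D1 (F : nat -> R) e : (e < n)%N ->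
  \sum_(0 <= f < n) F f = F e + \sum_(0 <= f < n) (if f == e then 0 else F f).
Proof.
move=> he; rewrite -[F e](sum_delta F he) -big_split /=.
by apply: eq_bigr => i _; case: eqP => _; rewrite ?mul1r ?addr0 ?mul0r ?add0r.
Qed.

Lemma active_load c mu sel v e : good c mu sel -> active c sel e -> (v < nv)%N ->
  inc v e ->
  [/\ 0 <= x e * mu v, x e * mu v <= 1, 1 <= (c v)%:R :> R &
  \sum_(0 <= f < n) (if f == e then 0 else load mu sel v f) <= (c v)%:R - x e * mu v].
Proof.
move=> gd ae hv iv; have [h1 h2 h3 h4 h5] := gd.
have cv := activeP ae hv iv; have [he /eqP se _] := and3P ae.
have /andP[x0 x1] := x01 he; have /andP[m0 m1] := h3 v hv.
split; rewrite ?mulr_ge0 ?mulr_ile1 ?ler1n //.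
have := h5 v hv; rewrite (big_nat_D1 _ he) /load iv se eqxx /=; lra.
Qed.

(** Without e, the load at v is at most c_v - x_e mu_v, and the factor (c_v - 1) / (c_v - x_e mu_v)
    scales this bound to c_v - 1. *)
Lemma good_accept c mu sel e : good c mu sel -> active c sel e ->
  good (acap c e) (amul c mu e) (asel sel e).
Proof.
move=> gd ae; have [h1 h2 h3 h4 h5] := gd; have [he /eqP se _] := and3P ae.
split=> [f hf|v hv|v hv|v hv|v hv]; rewrite /acap /amul /asel.
- by case: eqP => // _; exact: h1.
- have E (F : nat -> nat) : \sum_(0 <= f < n) F f =
      (F e + \sum_(0 <= f < n) (if f == e then 0 else F f))%N.
    rewrite (bigD1_seq e) ?mem_index_iota ?iota_uniq //= big_mkcond.
    by congr (_ + _)%N; apply: eq_bigr => i _; case: eqP.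
  rewrite -(h2 v hv) (E (fun f => inc v f * sel f)%N).
  rewrite (E (fun f => inc v f * (if f == e then 1 else sel f))%N).
  rewrite eqxx se muln0 muln1 add0n.
  have -> : (\sum_(0 <= f < n) (if f == e then 0 else inc v f * (if f == e then 1 else sel f))
    = \sum_(0 <= f < n) (if f == e then 0 else inc v f * sel f))%N.
    by apply: eq_bigr => f _; case: eqP.
  by case: ifP => [iv|_]; [have := activeP ae hv iv|]; lia.
- case: ifP => [iv|_]; last exact: h3.
  have [z0 z1 c1 _] := active_load gd ae hv iv; have /andP[m0 m1] := h3 v hv.
  (* The denominator vanishes only for c_v = 1 and x_e mu_v = 1; division by 0 then sets the
     multiplier to 0, as wanted. *)
  rewrite /shrink; have [->|nz] := eqVneq ((c v)%:R - x e * mu v) 0.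
    by rewrite invr0 mulr0 lexx ler01.
  have p : 0 < (c v)%:R - x e * mu v by rewrite lt_neqAle eq_sym nz; lra.
  have q0 : 0 <= mu v * ((c v)%:R - 1) by apply: mulr_ge0 => //; lra.
  apply/andP; split; first exact: divr_ge0 q0 (ltW p).
  rewrite ler_pdivrMr // mul1r.
  have : mu v * ((c v)%:R - 1) <= (c v)%:R - 1 by rewrite ler_piMl //; lra.
  lra.
- case: ifP => [iv hc|_]; last exact: h4.
  have cv := activeP ae hv iv; have -> : c v = 1%N by lia.
  by rewrite /shrink subrr mulr0 mul0r.
- case: ifP => [iv|niv]; last first.
    have := h5 v hv; apply: le_trans; apply: ler_sum => f _; rewrite /load.
    by have [->|_] := eqVneq f e; rewrite niv.
  have [z0 z1 c1 hs] := active_load gd ae hv iv.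
  have cv := activeP ae hv iv; rewrite natrB //.
  set r := ((c v)%:R - 1) / ((c v)%:R - x e * mu v).
  have -> : \sum_(0 <= f < n) load (amul c mu e) (asel sel e) v f =
     (\sum_(0 <= f < n) (if f == e then 0 else load mu sel v f)) * r.
    rewrite mulr_suml; apply: eq_bigr => f _; rewrite /load /amul /asel iv /shrink.
    have [_|_] := eqVneq f e; first by rewrite andbF mul0r.
    by case: ifP => _; rewrite ?mul0r // /r; ring.
  rewrite /r; have [->|nz] := eqVneq ((c v)%:R - x e * mu v) 0.
    by rewrite invr0 !mulr0 subr_ge0.
  have p : 0 < (c v)%:R - x e * mu v by rewrite lt_neqAle eq_sym nz; lra.
  rewrite mulrA ler_pdivrMr // mulrC ler_wpM2l //; lra.
Qed.

Lemma flowmx_act c mu sel e f :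
  ~~ active c sel e || ~~ active c sel f -> flowmx c mu sel e f = 0.
Proof. by rewrite -negb_and /flowmx => /negbTE ->. Qed.

Lemma flowmx_ge0 c mu sel e f : good c mu sel -> e != f -> 0 <= flowmx c mu sel e f.
Proof.
move=> gd ef; rewrite /flowmx; case: ifP => // /andP[ae af].
rewrite big_nat; apply: sumr_ge0 => v hv; rewrite /flow (negbTE ef).
case: ifP => // /andP[ie jf].
have [z0 z1 c1 _] := active_load gd ae hv ie.
have [y0 y1 _ _] := active_load gd af hv jf.
by apply: divr_ge0; [apply: mulr_ge0|]; lra.
Qed.

(** Already true vertex by vertex: the other edges carry load at most c_v - x_e mu_v, which cancels
    the denominator of [k] and leaves the diagonal term. *)
Lemma flowmx_sum c mu sel e : good c mu sel -> (e < n)%N ->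
  \sum_(0 <= f < n) flowmx c mu sel e f <= 0.
Proof.
move=> gd he; have [ae|ae] := boolP (active c sel e); last first.
  by rewrite big1 // => f _; rewrite flowmx_act // ae.
apply: (@le_trans _ _ (\sum_(0 <= v < nv) \sum_(0 <= f < n)
   (if active c sel f then flow c mu e f v else 0))).
  rewrite exchange_big /=; apply: ler_sum => f _; rewrite /flowmx ae /=.
  by case: ifP => // _; rewrite big1.
rewrite big_nat; apply: sumr_le0 => v hv; rewrite (big_nat_D1 _ he) ae.
rewrite /flow eqxx andbb; case: ifP => iv; last first.
  by rewrite add0r big1 // => f _; case: eqP => // _; case: ifP.
have [z0 z1 c1 hs] := active_load gd ae hv iv.
set k := (1 - x e * mu v) / ((c v)%:R - x e * mu v).
have k0 : 0 <= k by rewrite divr_ge0 //; lra.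
apply: (@le_trans _ _ (- (1 - x e * mu v) +
   k * \sum_(0 <= f < n) (if f == e then 0 else load mu sel v f))).
  rewrite lerD2l mulr_sumr !big_nat; apply: ler_sum => f hf; rewrite /load.
  have [fe|fe] := eqVneq f e; first by rewrite mulr0.
  rewrite /=.
  case: ifP => [/and3P[_ -> _]|_]; rewrite ?andbT.
    case: ifP => jf; rewrite ?mulr0 // /k le_eqVlt; apply/orP; left; apply/eqP; ring.
  have /andP[x0 _] := x01 hf; have /andP[m0 _] : 0 <= mu v <= 1 by case: gd => _ _ /(_ v hv).
  by case: ifP => _; [exact: mulr_ge0 k0 (mulr_ge0 x0 m0)|rewrite mulr0].
rewrite addrC subr_le0; have [z|nz] := eqVneq ((c v)%:R - x e * mu v) 0.
  by rewrite /k z invr0 mulr0 mul0r; lra.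
have p : 0 < (c v)%:R - x e * mu v by rewrite lt_neqAle eq_sym nz; lra.
apply: le_trans (ler_wpM2l k0 hs) _; rewrite /k divfK //.
Qed.

Section Potential.
Variable f : nat.
Hypothesis fn : (f < n)%N.

Definition gap := \sum_(0 <= v < nv) (if inc v f then 1 - x f else 0) + x f.
Definition deficit mu := \sum_(0 <= v < nv) (if inc v f then 1 - mu v else 0).

(** Divided by [gap], this will bound from below the chance that f ends up selected. The maximum
    with 0 is taken because phi_f may become negative while f is still active. *)
Definition potential c mu sel : R :=
  if sel f != 0%N then gap
  else if active c sel f then Num.max 0 (x f - x f * deficit mu) else 0.

Lemma potential_ge0 c mu sel : 0 <= potential c mu sel.
Proof.
rewrite /potential; case: ifP => _; last by case: ifP => // _; rewrite le_max lexx.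
have /andP[x0 x1] := x01 fn; rewrite addr_ge0 // sumr_ge0 // => v _.
by case: ifP => // _; lra.
Qed.

(** The matrix entry is the exact change of phi_f, both for e = f and for e != f. An inequality
    remains only because of the maximum with 0 and because f may become blocked, when phi_f <= 0. *)
Lemma potential_accept c mu sel e : good c mu sel -> active c sel e -> active c sel f ->
  x f - x f * deficit mu - flowmx c mu sel e f <=
  potential (acap c e) (amul c mu e) (asel sel e).
Proof.
move=> gd ae af; rewrite /flowmx ae af /=.
have [ef|ef] := eqVneq e f.
  rewrite /potential /asel ef eqxx /= /gap.
  rewrite le_eqVlt; apply/orP; left; apply/eqP.
  rewrite addrAC -addrA -opprD [RHS]addrC; congr (_ + _).
  rewrite /deficit mulr_sumr -big_split -sumrN; apply: eq_bigr => v _ /=.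
  by rewrite /flow andbb eqxx; case: ifP => _; ring.
have st : asel sel e f = 0%N.
  by rewrite /asel eq_sym (negbTE ef); have [_ /eqP] := and3P af.
set D := deficit (amul c mu e).
have E : x f - x f * deficit mu - \sum_(0 <= v < nv) flow c mu e f v = x f - x f * D.
  rewrite -addrA -opprD; congr (_ - _).
  rewrite /D /deficit !mulr_sumr -big_split; apply: eq_big_nat => v hv /=.
  rewrite /flow (negbTE ef) /amul; case jf : (inc v f); last by rewrite andbF !mulr0 addr0.
  case ie : (inc v e) => /=; last by rewrite addr0.
  have [z0 z1 c1 hs] := active_load gd ae hv ie.
  rewrite /shrink; have [z|nz] := eqVneq ((c v)%:R - x e * mu v) 0; last by field.
  (* At a zero denominator the multiplier drops to 0 while the matrix entry records no loss. This
     agrees because e uses the whole capacity of v, forcing x_f mu_v = 0. *)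
  rewrite z invr0 !mulr0 subr0 addr0.
  have hf : load mu sel v f <= 0.
    rewrite z in hs; apply: le_trans hs; rewrite (big_nat_D1 _ fn).
    rewrite eq_sym (negbTE ef) lerDl big_nat sumr_ge0 // => i hi.
    by do 2![case: ifP => // _]; exact: (load_ge0 gd).
  have /eqP : load mu sel v f = 0 by apply: le_anti; rewrite hf (load_ge0 gd).
  have [_ sf _] := and3P af; rewrite /load jf sf /= => /eqP; lra.
rewrite E /potential st /=; case: ifP => [_|/negbT naf]; first by rewrite le_max lexx orbT.
suff D1 : 1 <= D by have /andP[x0 _] := x01 fn; rewrite subr_le0 ler_peMr.
have [_ _ h3 h4 _] := good_accept gd ae.
move: naf; rewrite /active fn st eqxx /= => /allPn [v]; rewrite mem_iota /= add0n => hv.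
rewrite negb_imply -eqn0Ngt => /andP[jf /eqP c0].
rewrite /D /deficit (big_cat_nat (n := v)) //=; last exact: ltnW.
rewrite (big_ltn (m := v)) // jf (h4 v hv c0) subr0 addrCA lerDl addr_ge0 // big_nat;
  apply: sumr_ge0 => i hi; case: ifP => // _; rewrite subr_ge0;
  (have /andP[] // : 0 <= amul c mu e i <= 1 by apply: h3; lia).
Qed.

(** Multiplying by the total mass of p avoids normalizing the law. *)
Lemma potential_step c mu sel (p : nat -> R) : good c mu sel -> active c sel f ->
  (forall e, 0 <= p e) -> (forall e, ~~ active c sel e -> p e = 0) ->
  \sum_(0 <= e < n) p e * flowmx c mu sel e f <= 0 ->
  potential c mu sel * (\sum_(0 <= e < n) p e) <=
  \sum_(0 <= e < n) p e * potential (acap c e) (amul c mu e) (asel sel e).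
Proof.
move=> gd af p0 pa pf.
have [_ /eqP sf _] := and3P af; rewrite {1}/potential sf af /=.
have [h|h] := leP (x f - x f * deficit mu) 0.
  by rewrite mul0r sumr_ge0 // => e _; rewrite mulr_ge0 ?potential_ge0.
apply: (@le_trans _ _ (\sum_(0 <= e < n)
    p e * (x f - x f * deficit mu - flowmx c mu sel e f))).
  under [X in _ <= X]eq_bigr do rewrite mulrBr.
  by rewrite sumrB -mulr_suml mulrC lerBrDr gerDl.
apply: ler_sum => e _; have [ae|ae] := boolP (active c sel e).
  by rewrite ler_wpM2l ?potential_accept.
by rewrite pa // !mul0r.
Qed.

End Potential.
End Round.

(** * A language of bounded loops, compiled to the real RAM *)

(** [OFF] holds row offsets, [CAP] the remaining capacities c_v, [SEL] the selected edges, [ACT] the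
    edges still eligible, [FLAG] whether the current round has selected. *)
Inductive narr := OFF | CAP | SEL | ACT | FLAG.
(** [RND] holds the draw, [MUL] the multipliers, [MAT] the balance matrix, [PRB] the unnormalized
    law and [TOT] its mass; [ACC] accumulates a column sum and [REM] is the remainder of the
    draw. *)
Inductive rarr := RND | MUL | MAT | PRB | ACC | TOT | REM.

Definition ncode (a : narr) : nat :=
  match a with OFF => 1 | CAP => 2 | SEL => 3 | ACT => 4 | FLAG => 5 end.

(** Code 0 is available here, since the counters occupy it in the integer memory only. *)
Definition rcode (a : rarr) : nat :=
  match a with RND => 0 | MUL => 1 | MAT => 2 | PRB => 3 | ACC => 4 | TOT => 5
  | REM => 6 end.

Inductive nterm :=
  | Nc of nat
  | Nv of nat
  | Na of narr & nterm
  | Nlow of nterm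
  | Nadd of nterm & nterm
  | Nsub of nterm & nterm.

Inductive rterm :=
  | Rn of nterm
  | Ra of rarr & nterm
  | Rlow of nterm
  | Radd of rterm & rterm
  | Rsub of rterm & rterm
  | Rmul of rterm & rterm
  | Rdiv of rterm & rterm.

Inductive bterm :=
  | LeN of nterm & nterm
  | LeR of rterm & rterm
  | Not of bterm
  | And of bterm & bterm.

(* [For k p] runs [p] for i = 0, .., B - 1, where B is the value of the counter
   [k]; i is held by the first counter not used by the enclosing loops. *)
Inductive prog :=
  | Nop
  | Hn of narr & nterm & nterm
  | Hr of rarr & nterm & rterm
  | Out of nterm & nterm
  | Then of prog & prog
  | Cond of bterm & prog & prog
  | For of nat & prog.

(* Cell 0 holds the address P of the first free cell; entry i of the array with
   code c is at P + 8 i + c, and the counters form the array with code 0. *)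
Definition base : nexp := NLoad (NConst 0).
Definition dbl (e : nexp) := NAdd e e.
Definition cell (c : nat) (e : nexp) : nexp :=
  NAdd base (NAdd (dbl (dbl (dbl e))) (NConst c)).
Definition ctr (k : nat) : nexp := cell 0 (NConst k).
(* Reads of the input are clamped below P, which keeps them from depending on
   the layout of the arrays. *)
Definition clamp (e : nexp) : nexp :=
  NSub e (NSub (NAdd e (NConst 1)) base).

Fixpoint ncompile (d : nat) (e : nterm) : nexp :=
  match e with
  | Nc n => NConst n
  | Nv k => if (k < d)%N then NLoad (ctr k) else NConst 0
  | Na a i => NLoad (cell (ncode a) (ncompile d i))
  | Nlow i => NLoad (clamp (ncompile d i))
  | Nadd e1 e2 => NAdd (ncompile d e1) (ncompile d e2)
  | Nsub e1 e2 => NSub (ncompile d e1) (ncompile d e2)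
  end.

Fixpoint rcompile (d : nat) (e : rterm) : rexp :=
  match e with
  | Rn n => RNat (ncompile d n)
  | Ra a i => RLoad (cell (rcode a) (ncompile d i))
  | Rlow i => RLoad (clamp (ncompile d i))
  | Radd e1 e2 => RAdd (rcompile d e1) (rcompile d e2)
  | Rsub e1 e2 => RSub (rcompile d e1) (rcompile d e2)
  | Rmul e1 e2 => RMul (rcompile d e1) (rcompile d e2)
  | Rdiv e1 e2 => RDiv (rcompile d e1) (rcompile d e2)
  end.

Fixpoint bcompile (d : nat) (e : bterm) : bexp :=
  match e with
  | LeN e1 e2 => BLeN (ncompile d e1) (ncompile d e2)
  | LeR e1 e2 => BLeR (rcompile d e1) (rcompile d e2)
  | Not e1 => BNot (bcompile d e1)
  | And e1 e2 => BAnd (bcompile d e1) (bcompile d e2)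
  end.

Definition ltN (e1 e2 : nexp) : bexp := BNot (BLeN e2 e1).

(* [d] is the number of counters in use; writing to cell 0 is ruled out because
   it holds the base address. *)
Fixpoint compile (d : nat) (p : prog) : cmd :=
  match p with
  | Nop => Skip
  | Hn a i e => SetN (cell (ncode a) (ncompile d i)) (ncompile d e)
  | Hr a i e => SetR (cell (rcode a) (ncompile d i)) (rcompile d e)
  | Out i e => If (BAnd (ltN (NConst 0) (ncompile d i))
                        (ltN (ncompile d i) base))
                  (SetN (ncompile d i) (ncompile d e)) Skip
  | Then p1 p2 => Seq (compile d p1) (compile d p2)
  | Cond b p1 p2 => If (bcompile d b) (compile d p1) (compile d p2)
  | For k p1 => Seq (SetN (ctr d) (NConst 0))
      (While (ltN (NLoad (ctr d)) (ncompile d (Nv k)))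
             (Seq (compile d.+1 p1)
                  (SetN (ctr d) (NAdd (NLoad (ctr d)) (NConst 1)))))
  end.

(** Each loop is charged P iterations. An iteration adds a test, a [Seq] and an increment to its
    body; the loop adds a [Seq], the initialization and the failing test. *)
Fixpoint cost (P : nat) (p : prog) : nat :=
  match p with
  | Nop | Hn _ _ _ | Hr _ _ _ => 1
  | Out _ _ => 2
  | Then p1 p2 | Cond _ p1 p2 => (1 + cost P p1 + cost P p2)%N
  | For _ p1 => (P * (cost P p1 + 3) + 3)%N
  end.

(** * Semantics of the loop language and correctness of its compilation *)

Section Language.
Variable R : realType.

Record memory := Memory {
  nlow : nat -> nat;
  rlow : nat -> R;
  nar : narr -> nat -> nat;
  rar : rarr -> nat -> R }.

Variable P : nat.

Fixpoint nden (v : seq nat) (m : memory) (e : nterm) : nat :=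
  match e with
  | Nc n => n
  | Nv k => nth 0%N v k
  | Na a i => nar m a (nden v m i)
  | Nlow i => nlow m (minn (nden v m i) P.-1)
  | Nadd e1 e2 => (nden v m e1 + nden v m e2)%N
  | Nsub e1 e2 => (nden v m e1 - nden v m e2)%N
  end.

Fixpoint rden (v : seq nat) (m : memory) (e : rterm) : R :=
  match e with
  | Rn n => (nden v m n)%:R
  | Ra a i => rar m a (nden v m i)
  | Rlow i => rlow m (minn (nden v m i) P.-1)
  | Radd e1 e2 => rden v m e1 + rden v m e2
  | Rsub e1 e2 => rden v m e1 - rden v m e2
  | Rmul e1 e2 => rden v m e1 * rden v m e2
  | Rdiv e1 e2 => rden v m e1 / rden v m e2
  end.

Fixpoint bden (v : seq nat) (m : memory) (e : bterm) : bool :=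
  match e with
  | LeN e1 e2 => (nden v m e1 <= nden v m e2)%N
  | LeR e1 e2 => rden v m e1 <= rden v m e2
  | Not e1 => ~~ bden v m e1
  | And e1 e2 => bden v m e1 && bden v m e2
  end.

Definition setn (m : memory) (a : narr) (i y : nat) : memory :=
  Memory (nlow m) (rlow m)
    (fun a' i' => if (ncode a' == ncode a) && (i' == i) then y else nar m a' i')
    (rar m).

Definition setr (m : memory) (a : rarr) (i : nat) (y : R) : memory :=
  Memory (nlow m) (rlow m) (nar m)
    (fun a' i' => if (rcode a' == rcode a) && (i' == i) then y else rar m a' i').

Definition out (m : memory) (i y : nat) : memory :=
  if (0 < i < P)%N then Memory (update (nlow m) i y) (rlow m) (nar m) (rar m)
  else m.

Fixpoint den (v : seq nat) (p : prog) (m : memory) : memory :=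
  match p with
  | Nop => m
  | Hn a i e => setn m a (nden v m i) (nden v m e)
  | Hr a i e => setr m a (nden v m i) (rden v m e)
  | Out i e => out m (nden v m i) (nden v m e)
  | Then p1 p2 => den v p2 (den v p1 m)
  | Cond b p1 p2 => if bden v m b then den v p1 m else den v p2 m
  | For k p1 =>
      foldl (fun m' i => den (rcons v i) p1 m') m (iota 0 (nth 0%N v k))
  end.

(** Only counters of enclosing loops are constrained, so leaving a loop requires no cleanup. *)
Definition rep (s : state R) (v : seq nat) (m : memory) : Prop :=
  [/\ nmem s 0 = P,
      forall j, (j < P)%N -> nmem s j = nlow m j /\ rmem s j = rlow m j,
      forall k, (k < size v)%N -> nmem s (P + 8 * k)%N = nth 0%N v k,
      forall a i, nmem s (P + 8 * i + ncode a)%N = nar m a i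
    & forall a i, rmem s (P + 8 * i + rcode a)%N = rar m a i].

(** Quantifying over the tape expresses that the command ignores the random numbers it consumes. *)
Definition steps (c : cmd) (s : state R) (n : nat) (s' : state R) : Prop :=
  forall k t, size t = n -> foldl (@step R) (c :: k, s) t = (k, s').

Lemma steps1 c s s' : (forall k u, step (c :: k, s) u = (k, s')) -> steps c s 1 s'.
Proof. by move=> H k [|u [|]] // _; exact: H. Qed.

Lemma steps_seq c1 c2 s n1 s1 n2 s2 :
  steps c1 s n1 s1 -> steps c2 s1 n2 s2 -> steps (Seq c1 c2) s (1 + n1 + n2) s2.
Proof.
move=> H1 H2 k [|u t] //= [st]; rewrite -(cat_take_drop n1 t) foldl_cat.
rewrite H1 ?size_take ?H2 // ?size_drop; last by case: ltnP; lia.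
by rewrite st; lia.
Qed.

Lemma steps_if b c1 c2 s n s' :
  steps (if beval s b then c1 else c2) s n s' -> steps (If b c1 c2) s n.+1 s'.
Proof. by move=> H k [|u t] //= [st]; rewrite H. Qed.

Lemma steps_while_false b c s : ~~ beval s b -> steps (While b c) s 1 s.
Proof. by move=> /negbTE H; apply: steps1 => k u /=; rewrite H. Qed.

Lemma steps_while_true b c s n1 s1 n2 s2 :
  beval s b -> steps c s n1 s1 -> steps (While b c) s1 n2 s2 ->
  steps (While b c) s (1 + n1 + n2) s2.
Proof.
move=> H H1 H2 k [|u t] //= [st]; rewrite H -(cat_take_drop n1 t) foldl_cat.
rewrite H1 ?size_take ?H2 // ?size_drop; last by case: ltnP; lia.
by rewrite st; lia.
Qed.

Lemma neval_cell s v m c e : rep s v m ->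
  neval s (cell c e) = (P + 8 * neval s e + c)%N.
Proof. by case=> H0 _ _ _ _ /=; rewrite H0; lia. Qed.

Lemma neval_ctr s v m k : rep s v m -> neval s (ctr k) = (P + 8 * k)%N.
Proof. by move=> H; rewrite (neval_cell _ _ H) /= addn0. Qed.

Hypothesis P_gt0 : (0 < P)%N.

Lemma neval_clamp s v m e : rep s v m ->
  neval s (clamp e) = minn (neval s e) P.-1.
Proof. by case=> H0 _ _ _ _ /=; rewrite H0; lia. Qed.

Lemma ncompileP s v m e : rep s v m ->
  neval s (ncompile (size v) e) = nden v m e.
Proof.
move=> H; have [H0 Hl Hc Hn Hr] := H.
elim: e => [n|k|a i IH|i IH|e1 IH1 e2 IH2|e1 IH1 e2 IH2] //.
- rewrite [ncompile _ _]/=; case: ltnP => hk; last by rewrite /= nth_default.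
  by rewrite -[LHS]/(nmem s (neval s (ctr k))) (neval_ctr _ H) Hc.
- rewrite -[LHS]/(nmem s (neval s (cell (ncode a) (ncompile (size v) i)))).
  by rewrite (neval_cell _ _ H) IH Hn.
- rewrite -[LHS]/(nmem s (neval s (clamp (ncompile (size v) i)))).
  by rewrite (neval_clamp _ H) IH (proj1 (Hl _ _)) //; lia.
- by rewrite /= IH1 IH2.
- by rewrite /= IH1 IH2.
Qed.

Lemma rcompileP s v m e : rep s v m ->
  reval s (rcompile (size v) e) = rden v m e.
Proof.
move=> H; have [H0 Hl Hc Hn Hr] := H.
elim: e => [n|a i|i|e1 IH1 e2 IH2|e1 IH1 e2 IH2|e1 IH1 e2 IH2|e1 IH1 e2 IH2].
- by rewrite /= (ncompileP _ H).
- rewrite -[LHS]/(rmem s (neval s (cell (rcode a) (ncompile (size v) i)))).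
  by rewrite (neval_cell _ _ H) (ncompileP _ H) Hr.
- rewrite -[LHS]/(rmem s (neval s (clamp (ncompile (size v) i)))).
  by rewrite (neval_clamp _ H) (ncompileP _ H) (proj2 (Hl _ _)) //; lia.
all: by rewrite /= IH1 IH2.
Qed.

Lemma bcompileP s v m e : rep s v m ->
  beval s (bcompile (size v) e) = bden v m e.
Proof.
move=> H; elim: e => [e1 e2|e1 e2|e IH|e1 IH1 e2 IH2] /=.
- by rewrite !(ncompileP _ H).
- by rewrite !(rcompileP _ H).
- by rewrite IH.
- by rewrite IH1 IH2.
Qed.

Lemma rep_setn s v m a i y : rep s v m ->
  rep (State (update (nmem s) (P + 8 * i + ncode a) y) (rmem s)) v
      (setn m a i y).
Proof.
have ha b : (0 < ncode b < 8)%N by case: b.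
case=> H0 Hl Hc Hn Hr; split => //=; rewrite /update.
- by case: eqP => // e; lia.
- by move=> j hj; case: eqP => [e|_]; [lia|exact: Hl].
- by move=> k hk; case: eqP => [e|_]; [have := ha a; lia|exact: Hc].
- move=> a' i'; rewrite Hn; congr (if _ then _ else _).
  have := ha a; have := ha a'; lia.
Qed.

Lemma rep_setr s v m a i y : rep s v m ->
  rep (State (nmem s) (update (rmem s) (P + 8 * i + rcode a) y)) v
      (setr m a i y).
Proof.
have ha b : (rcode b < 8)%N by case: b.
case=> H0 Hl Hc Hn Hr; split => //=; rewrite /update.
- by move=> j hj; case: eqP => [e|_]; [lia|exact: Hl].
- move=> a' i'; rewrite Hr; congr (if _ then _ else _).
  have := ha a; have := ha a'; lia.
Qed.

Lemma rep_ctr s v m i : rep s v m ->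
  rep (State (update (nmem s) (P + 8 * size v) i) (rmem s)) (rcons v i) m.
Proof.
have ha b : (0 < ncode b < 8)%N by case: b.
case=> H0 Hl Hc Hn Hr; split => //=; rewrite /update.
- by case: eqP => // e; lia.
- by move=> j hj; case: eqP => [e|_]; [lia|exact: Hl].
- move=> k; rewrite size_rcons nth_rcons ltnS leq_eqVlt => /orP[/eqP->|hk].
    by rewrite eqxx ltnn eqxx.
  by rewrite hk; case: eqP => [e|_]; [lia|exact: Hc].
- by move=> a j; case: eqP => [e|_]; [have := ha a; lia|exact: Hn].
Qed.

Lemma rep_rcons s v i m : rep s (rcons v i) m -> rep s v m.
Proof.
case=> H0 Hl Hc Hn Hr; split => // k hk.
have := Hc k; rewrite size_rcons nth_rcons hk => -> //; lia.
Qed.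

Lemma neval_load_ctr s v m k : rep s v m -> (k < size v)%N ->
  neval s (NLoad (ctr k)) = nth 0%N v k.
Proof.
move=> H hk; have [_ _ Hc _ _] := H; rewrite -Hc //.
by rewrite -(neval_ctr k H).
Qed.

Lemma neval_load_last s v i m : rep s (rcons v i) m ->
  neval s (NLoad (ctr (size v))) = i.
Proof.
by move=> H; rewrite (neval_load_ctr H) ?size_rcons // nth_rcons ltnn eqxx.
Qed.

(** A loop bound is the value of an enclosing counter, and these stay below or at P; this justifies
    charging P iterations. *)
Lemma compileP p : forall s v m, rep s v m -> all (leq^~ P) v ->
  exists n s', [/\ (n <= cost P p)%N, steps (compile (size v) p) s n s' &
                   rep s' v (den v p m)].
Proof.
elim: p => [|a i e|a i e|i e|p1 IH1 p2 IH2|b p1 IH1 p2 IH2|k p IH] s v m H hv.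
- by exists 1%N, s; split => //; apply: steps1.
- exists 1%N; eexists; split; [by []|by apply: steps1 => l u; reflexivity|].
  rewrite (neval_cell _ _ H) !(ncompileP _ H); exact: rep_setn.
- exists 1%N; eexists; split; [by []|by apply: steps1 => l u; reflexivity|].
  rewrite (neval_cell _ _ H) (ncompileP _ H) (rcompileP _ H); exact: rep_setr.
- exists 2%N.
  have E : beval s (BAnd (ltN (NConst 0) (ncompile (size v) i))
     (ltN (ncompile (size v) i) base)) = (0 < nden v m i < P)%N.
    by case: H (ncompileP i H) => H0 _ _ _ _ <-; rewrite /= H0 -!ltnNge.
  rewrite /= /out; case: ifP => hi; rewrite hi in E.
    eexists; split => //; first by apply: steps_if; rewrite E; apply: steps1 => l u; reflexivity.
    rewrite !(ncompileP _ H).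
    have ha b : (0 < ncode b < 8)%N by case: b.
    case: H => H0 Hl Hc Hn Hr; split => //=; rewrite /update.
    + by case: eqP => // e'; lia.
    + by move=> j hj; case: eqP => [e'|_]; [split => //; case: (Hl j hj)|exact: Hl].
    + by move=> l hl; case: eqP => [e'|_]; [lia|exact: Hc].
    + by move=> a l; case: eqP => [e'|_]; [lia|exact: Hn].
  eexists; split => //; last by exact: H.
  by apply: steps_if; rewrite E; apply: steps1 => l u; reflexivity.
- have [n1 [s1 [h1 S1 R1]]] := IH1 _ _ _ H hv.
  have [n2 [s2 [h2 S2 R2]]] := IH2 _ _ _ R1 hv.
  by exists (1 + n1 + n2)%N, s2; split => //=; [lia|exact: steps_seq S1 S2].
- have [n1 [s1 [h1 S1 R1]]] := IH1 _ _ _ H hv.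
  have [n2 [s2 [h2 S2 R2]]] := IH2 _ _ _ H hv.
  rewrite /=; case: ifPn => hb.
    exists n1.+1, s1; split => //; first lia.
    by apply: steps_if; rewrite (bcompileP _ H) hb.
  exists n2.+1, s2; split => //; first lia.
  by apply: steps_if; rewrite (bcompileP _ H) (negbTE hb).
- set B := nth 0%N v k.
  have hB : (B <= P)%N.
    by rewrite /B; case: (ltnP k (size v)) => hk; [apply: (allP hv); exact: mem_nth|rewrite nth_default].
  pose w := While (ltN (NLoad (ctr (size v))) (ncompile (size v) (Nv k)))
    (Seq (compile (size v).+1 p)
       (SetN (ctr (size v)) (NAdd (NLoad (ctr (size v))) (NConst 1)))).
  (* Induction on the number j of iterations still to come. *)
  have L j : forall i s m, (i + j = B)%N -> rep s (rcons v i) m ->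
    exists n s', [/\ (n <= j * (cost P p + 3) + 1)%N, steps w s n s' &
      rep s' v (foldl (fun m' i => den (rcons v i) p m') m (iota i j))].
    elim: j => [|j IHj] i s' m' hi H'.
      exists 1%N, s'; split; [by []| |exact: rep_rcons H'].
      apply: steps_while_false; rewrite negbK.
      by rewrite (ncompileP _ (rep_rcons H')) (neval_load_last H') /= -/B; lia.
    have hv' : all (leq^~ P) (rcons v i) by rewrite all_rcons hv andbT; lia.
    have [n1 [s1 [h1 S1 R1]]] := IH _ _ _ H' hv'.
    rewrite size_rcons in S1.
    pose s2 := State (update (nmem s1) (P + 8 * size v) i.+1) (rmem s1).
    have R2 : rep s2 (rcons v i.+1) (den (rcons v i) p m').
      exact: rep_ctr (rep_rcons R1).
    have [|n3 [s3 [h3 S3 R3]]] := IHj i.+1 s2 (den (rcons v i) p m') _ R2; first by rewrite addSnnS.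
    exists (1 + (1 + n1 + 1) + n3)%N, s3; split => //; first lia.
    apply: (steps_while_true (s1 := s2)) => //.
      rewrite -[beval _ _]/(~~ (neval s' (ncompile (size v) (Nv k)) <= neval s' (NLoad (ctr (size v))))%N).
      by rewrite (ncompileP _ (rep_rcons H')) (neval_load_last H') /= -/B; lia.
    apply: (steps_seq S1); apply: steps1 => l u.
    rewrite -[LHS]/(l, State (update (nmem s1) (neval s1 (ctr (size v)))
      (neval s1 (NLoad (ctr (size v))) + 1)%N) (rmem s1)).
    by rewrite (neval_load_last R1) (neval_ctr _ R1) addn1.
  have [n2 [s2 [h2 S2 R2]]] := L B 0%N _ _ erefl (rep_ctr 0%N H).
  exists (1 + 1 + n2)%N, s2; split; [rewrite [cost _ _]/=| |exact: R2].
    have : (B * (cost P p + 3) <= P * (cost P p + 3))%N by rewrite leq_mul2r hB orbT.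
    lia.
  apply: (steps_seq (s1 := State (update (nmem s) (P + 8 * size v) 0%N) (rmem s))) S2.
  apply: steps1 => l u; by rewrite -[LHS]/(l, State (update (nmem s) (neval s (ctr (size v))) 0%N) (rmem s)) (neval_ctr _ H).
Qed.

End Language.

(** * Correctness of the program of one round *)

(** The set of written arrays is computed from the syntax, so that frame conditions hold by
    evaluation. *)
Fixpoint nwrites (p : prog) : seq nat :=
  match p with
  | Hn a _ _ => [:: ncode a]
  | Then p1 p2 | Cond _ p1 p2 => nwrites p1 ++ nwrites p2
  | For _ p1 => nwrites p1
  | _ => [::]
  end.

Fixpoint rwrites (p : prog) : seq nat :=
  match p with
  | Hr a _ _ => [:: rcode a]
  | Then p1 p2 | Cond _ p1 p2 => rwrites p1 ++ rwrites p2
  | For _ p1 => rwrites p1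
  | _ => [::]
  end.

Fixpoint outputs (p : prog) : bool :=
  match p with
  | Out _ _ => true
  | Then p1 p2 | Cond _ p1 p2 => outputs p1 || outputs p2
  | For _ p1 => outputs p1
  | _ => false
  end.

Definition When (b : bterm) (p : prog) : prog := Cond b p Nop.

Section Frame.
Variables (R : realType) (P : nat).

Implicit Types m : memory R.

Definition frame (p : prog) (m m' : memory R) : Prop :=
  [/\ forall a, ncode a \notin nwrites p -> nar m' a = nar m a,
      forall a, rcode a \notin rwrites p -> rar m' a = rar m a,
      rlow m' = rlow m & ~~ outputs p -> nlow m' = nlow m].

Lemma frame_refl p m : frame p m m. Proof. by []. Qed.

Lemma frame_trans p m1 m2 m3 : frame p m1 m2 -> frame p m2 m3 -> frame p m1 m3.
Proof.
move=> [a1 b1 c1 d1] [a2 b2 c2 d2]; split=> [a h|a h||h].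
- by rewrite a2 ?a1.
- by rewrite b2 ?b1.
- by rewrite c2.
- by rewrite d2 ?d1.
Qed.

Lemma denF p : forall v m, frame p m (den P v p m).
Proof.
elim: p => [|a i e|a i e|i e|p1 IH1 p2 IH2|b p1 IH1 p2 IH2|k p IH] v m.
- exact: frame_refl.
- split=> //= a'; rewrite inE => /negbTE h; apply/funext => j; by rewrite h.
- split=> //= a'; rewrite inE => /negbTE h; apply/funext => j; by rewrite h.
- by rewrite /= /out; case: ifP => _; split.
- have [a1 b1 c1 d1] := IH1 v m; have [a2 b2 c2 d2] := IH2 v (den P v p1 m).
  split=> //= [a|a||]; rewrite ?mem_cat ?negb_or.
  + by case/andP => h1 h2; rewrite a2 // a1.
  + by case/andP => h1 h2; rewrite b2 // b1.
  + by rewrite c2.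
  + by case/andP => h1 h2; rewrite d2 // d1.
- have [a1 b1 c1 d1] := IH1 v m; have [a2 b2 c2 d2] := IH2 v m.
  by case E: (bden P v m b); rewrite /= E; split=> //= [a|a|];
    rewrite ?mem_cat ?negb_or => /andP[h1 h2]; auto.
- rewrite [den _ _ _]/=; elim: (iota _ _) m => [|i s IHs] m; first exact: frame_refl.
  by apply: frame_trans (IHs _); exact: IH.
Qed.

Lemma den_then v p1 p2 m : den P v (Then p1 p2) m = den P v p2 (den P v p1 m).
Proof. by []. Qed.

Lemma den_when v c p m :
  den P v (When c p) m = if bden P v m c then den P v p m else m.
Proof. by rewrite /=; case: ifP. Qed.

Lemma den_cond v c p1 p2 m :
  den P v (Cond c p1 p2) m = if bden P v m c then den P v p1 m else den P v p2 m.
Proof. by rewrite /=; case: ifP. Qed.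

Lemma den_hn v a i e m : den P v (Hn a i e) m = setn m a (nden P v m i) (nden P v m e).
Proof. by []. Qed.

Lemma den_hr v a i e m : den P v (Hr a i e) m = setr m a (nden P v m i) (rden P v m e).
Proof. by []. Qed.

Lemma bden_and v m b1 b2 : bden P v m (And b1 b2) = bden P v m b1 && bden P v m b2.
Proof. by []. Qed.

(** The frame supplied to the body covers everything the loop does not write, so an invariant need
    only mention what changes. *)
Lemma forP (I : nat -> memory R -> Prop) v k p m B :
  nth 0%N v k = B -> I 0%N m ->
  (forall i m', (i < B)%N -> frame p m m' -> I i m' ->
     I i.+1 (den P (rcons v i) p m')) ->
  I B (den P v (For k p) m).
Proof.
move=> <- I0 IS; set B' := nth 0%N v k.
suff L j : forall i m', (i + j = B')%N -> frame p m m' -> I i m' ->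
    I B' (foldl (fun m' i => den P (rcons v i) p m') m' (iota i j)).
  exact: (L B' 0%N m) (frame_refl _ _) I0.
elim: j => [|j IH] i m' h F Ii; first by rewrite addn0 in h; rewrite -h.
apply: IH; first by rewrite addSnnS.
  exact: frame_trans F (denF _ _ _).
by apply: IS => //; rewrite -/B'; lia.
Qed.

End Frame.

(** * Programs of the procedure; counters 0 and 1 hold |E| and |V| *)

Definition Seqs (l : seq prog) : prog := foldr Then Nop l.
Definition NE := Nv 0.
Definition NV := Nv 1.
Definition Zero := Nc 0.
Definition One := Nc 1.
Definition RZero := Rn Zero.
Definition ROne := Rn One.
Definition ifIn (v e : nterm) : bterm :=
  LeN One (Nlow (Nadd (Nc 2) (Nadd (Na OFF v) e))).
Definition ifAct (e : nterm) : bterm := LeN One (Na ACT e).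
Definition LtN (e1 e2 : nterm) : bterm := Not (LeN e2 e1).
Definition EqN (e1 e2 : nterm) : bterm := And (LeN e1 e2) (LeN e2 e1).
Definition Or (b1 b2 : bterm) : bterm := Not (And (Not b1) (Not b2)).
Definition idx (i j : nterm) : nterm := Nadd (Na OFF i) j.
Definition Mat (i j : nterm) : rterm := Ra MAT (idx i j).
Definition mass (v e : nterm) : rterm := Rmul (Rlow e) (Ra MUL v).
Definition residue (v e : nterm) : rterm := Rsub (Rn (Na CAP v)) (mass v e).

(** Multiples of |E| by repeated addition, as integers cannot be multiplied. The table is filled
    over both index ranges: rows of the incidence matrix belong to vertices, rows of [MAT] to
    edges. *)
Definition table : prog := Hn OFF (Nadd (Nv 2) One) (Nadd (Na OFF (Nv 2)) NE).
Definition setup : prog :=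
  Seqs [:: For 1 table; For 0 table;
    For 1 (Then
      (Hn CAP (Nv 2) (Nlow (Nadd (Nc 2) (Nadd (Na OFF NV) (Nv 2)))))
      (Hr MUL (Nv 2) ROne))].

Definition mark : prog :=
  For 0 (Then (Hn ACT (Nv 3) (Nsub One (Na SEL (Nv 3))))
    (For 1 (When (And (ifIn (Nv 4) (Nv 3)) (LeN (Na CAP (Nv 4)) Zero))
       (Hn ACT (Nv 3) Zero)))).

Definition fillstep : prog :=
  Cond (EqN (Nv 3) (Nv 4))
    (Hr MAT (idx (Nv 3) (Nv 4))
       (Rsub (Mat (Nv 3) (Nv 4)) (Rsub ROne (mass (Nv 5) (Nv 3)))))
    (Hr MAT (idx (Nv 3) (Nv 4))
       (Radd (Mat (Nv 3) (Nv 4))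
          (Rdiv (Rmul (mass (Nv 5) (Nv 4)) (Rsub ROne (mass (Nv 5) (Nv 3))))
                (residue (Nv 5) (Nv 3))))).

Definition fillmx : prog :=
  For 0 (For 0 (Then (Hr MAT (idx (Nv 3) (Nv 4)) RZero)
    (For 1 (When (And (And (ifAct (Nv 3)) (ifAct (Nv 4)))
                      (And (ifIn (Nv 5) (Nv 3)) (ifIn (Nv 5) (Nv 4))))
       fillstep)))).

Definition eliminate : prog :=
  For 0 (For 0 (For 0 (When (And (LtN (Nv 3) (Nv 4)) (LtN (Nv 3) (Nv 5)))
    (Hr MAT (idx (Nv 4) (Nv 5))
       (Rsub (Mat (Nv 4) (Nv 5))
             (Rdiv (Rmul (Mat (Nv 4) (Nv 3)) (Mat (Nv 3) (Nv 5)))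
                   (Mat (Nv 3) (Nv 3)))))))).

(** Loops count upwards, whereas back substitution runs from the last state down. *)
Definition pivot : nterm := Nsub NE (Nadd (Nv 3) One).

Definition backstep : prog :=
  Seqs [:: Hr ACC Zero RZero;
    For 0 (Hr ACC Zero (Radd (Ra ACC Zero)
      (Rmul (Ra PRB (Nv 4)) (Mat (Nv 4) pivot))));
    Cond (And (ifAct pivot)
              (Or (LeR RZero (Mat pivot pivot)) (LeR (Ra TOT Zero) RZero)))
      (Seqs [:: For 0 (Hr PRB (Nv 4) RZero); Hr PRB pivot ROne; Hr TOT Zero ROne])
      (Seqs [:: Hr PRB pivot (Rsub RZero (Rdiv (Ra ACC Zero) (Mat pivot pivot)));
                Hr TOT Zero (Radd (Ra TOT Zero) (Ra PRB pivot))])].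

Definition backsub : prog :=
  Seqs [:: For 0 (Hr PRB (Nv 3) RZero); Hr TOT Zero RZero; For 0 backstep].

(** The multiplier is updated before the capacity because its new value uses the old capacity. *)
Definition accept : prog :=
  Then (Hn SEL (Nv 3) One)
    (For 1 (When (ifIn (Nv 4) (Nv 3)) (Then
       (Hr MUL (Nv 4) (Rdiv (Rmul (Ra MUL (Nv 4)) (Rsub (Rn (Na CAP (Nv 4))) ROne))
                            (residue (Nv 4) (Nv 3))))
       (Hn CAP (Nv 4) (Nsub (Na CAP (Nv 4)) One))))).

(** Inverse transform sampling: the draw is scaled by the total mass and the masses are subtracted
    until one covers the remainder. *)
Definition select : prog :=
  Seqs [:: Hr REM Zero (Rmul (Ra RND Zero) (Ra TOT Zero)); Hn FLAG Zero Zero;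
    For 0 (When (And (ifAct (Nv 3)) (LeN (Na FLAG Zero) Zero))
      (Cond (LeR (Ra REM Zero) (Ra PRB (Nv 3)))
         (Then (Hn FLAG Zero One) accept)
         (Hr REM Zero (Rsub (Ra REM Zero) (Ra PRB (Nv 3))))))].

Definition round : prog := Seqs [:: mark; fillmx; eliminate; backsub; select].

Definition copyout : prog := For 0 (Out (Nv 2) (Na SEL (Nv 2))).

(** * Effect of each program on the memory *)

Section Spec.
Variables (R : realType) (P n nv : nat) (inc : nat -> nat -> bool).
Variables (x : nat -> R) (b : nat -> nat).
Hypothesis P_big : (nv * n + nv + n + 4 <= P)%N.

Definition data (m : memory R) : Prop :=
  [/\ forall v e, (v < nv)%N -> (e < n)%N -> nlow m (2 + (v * n + e))%N = inc v e,
      forall e, (e < n)%N -> rlow m e = x e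
    & forall j, (j < nv)%N || (j < n)%N -> nar m OFF j = (j * n)%N].

Lemma data_frame p m m' : frame p m m' -> ncode OFF \notin nwrites p ->
  ~~ outputs p -> data m -> data m'.
Proof.
by move=> [F1 _ F3 F4] h1 h2 [d1 d2 d3]; split; rewrite ?F4 ?F3 ?F1.
Qed.

Lemma idx_lt v e : (v < nv)%N -> (e < n)%N -> (2 + (v * n + e) < P)%N.
Proof.
move=> hv he; have : (v.+1 * n <= nv * n)%N by rewrite leq_mul2r hv orbT.
rewrite mulSn; lia.
Qed.

Lemma bden_ifIn env m tv te v e : data m -> nden P env m tv = v ->
  nden P env m te = e -> (v < nv)%N -> (e < n)%N ->
  bden P env m (ifIn tv te) = inc v e.
Proof.
move=> [d1 _ d3] Ev Ee hv he /=; rewrite Ev Ee d3 ?hv // (minn_idPl _).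
  by rewrite d1 //; case: inc.
by have := idx_lt hv he; lia.
Qed.

Lemma rden_low env m te e : data m -> nden P env m te = e -> (e < n)%N ->
  rden P env m (Rlow te) = x e.
Proof.
by move=> [_ d2 _] Ee he /=; rewrite Ee (minn_idPl _) ?d2 //; lia.
Qed.

Lemma nden_idx env m ti tj i j : data m -> nden P env m ti = i ->
  nden P env m tj = j -> (i < n)%N -> nden P env m (idx ti tj) = (i * n + j)%N.
Proof. by move=> [_ _ d3] Ei Ej hi /=; rewrite Ei Ej d3 // hi orbT. Qed.

Lemma idx_inj i j i' j' : (j < n)%N -> (j' < n)%N ->
  ((i * n + j)%N == (i' * n + j')%N) = (i == i') && (j == j').
Proof.
move=> hj hj'; apply/eqP/andP => [h|[/eqP-> /eqP->] //].
have n0 : (0 < n)%N by lia.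
have : ((i * n + j) %/ n = (i' * n + j') %/ n)%N by rewrite h.
rewrite !divnMDl // !divn_small // !addn0 => E; rewrite E eqxx; split=> //.
by apply/eqP; rewrite E in h; lia.
Qed.

Variable r : nat.
Let env := [:: n; nv; r].

Lemma markP m : data m -> (forall e, (e < n)%N -> (nar m SEL e <= 1)%N) ->
  forall e, (e < n)%N ->
  nar (den P env mark m) ACT e = active n nv inc (nar m CAP) (nar m SEL) e.
Proof.
move=> dm s1.
pose I i (m' : memory R) := forall e, (e < i)%N -> nar m' ACT e = active n nv inc (nar m CAP) (nar m SEL) e.
suff : I n (den P env mark m) by [].
apply: (forP (I := I)) => // i m1 hi F1 I1.
rewrite den_then den_hn; set m2 := setn m1 ACT _ _.
have d2 : data m2.
  have := data_frame F1 isT isT dm; by rewrite /m2; case.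
pose J j (m' : memory R) := (forall e, (e < i)%N -> nar m' ACT e = nar m1 ACT e) /\
  nar m' ACT i = [&& (i < n)%N, nar m SEL i == 0%N & all (fun v => inc v i ==> (0 < nar m CAP v)%N) (iota 0 j)].
have [f1 _ _ _] := F1.
have [j1 j2] : J nv (den P (rcons env i) (For 1 (When (And (ifIn (Nv 4) (Nv 3)) (LeN (Na CAP (Nv 4)) Zero))
       (Hn ACT (Nv 3) Zero))) m2).
  apply: (forP (I := J)) => // [|j m3 hj F3 [J1 J2]].
    split=> [e he|] /=.
      by rewrite (ltn_eqF he).
    rewrite eqxx (f1 SEL) // hi andbT /=; have := s1 i hi; lia.
  have d3 := data_frame F3 isT isT d2.
  have [f3 _ _ _] := F3.
  rewrite den_when bden_and (bden_ifIn (v := j) (e := i) d3) //=.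
  have -> : nar m3 CAP j = nar m CAP j by rewrite f3 //= (f1 CAP).
  rewrite /J -[j.+1]addn1 iotaD all_cat /= andbT add0n.
  case: ifP => [/andP[h1 h2]|h] /=.
    split=> [e he|]; first by rewrite (ltn_eqF he) J1.
    have -> : nar m CAP j = 0%N by lia.
    by rewrite eqxx h1 !andbF.
  split=> //; rewrite J2.
  suff -> : inc j i ==> (0 < nar m CAP j)%N by rewrite andbT.
  by move: h; case: inc => //=; lia.
move=> e; rewrite ltnS leq_eqVlt => /orP[/eqP->|he]; first by rewrite j2.
by rewrite j1 // I1.
Qed.


(** In-place update in lexicographic order: entries before (i, j) are new, the others still old. *)
Lemma for2P v p m (A B : nat -> nat -> R) :
  (0 < size v)%N -> nth 0%N v 0 = n ->
  (forall i j, (i < n)%N -> (j < n)%N -> rar m MAT (i * n + j)%N = A i j) ->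
  (forall i j m', (i < n)%N -> (j < n)%N -> frame p m m' ->
    (forall i' j', (i' < n)%N -> (j' < n)%N -> rar m' MAT (i' * n + j')%N =
       if (i' < i)%N || (i' == i) && (j' < j)%N then B i' j' else A i' j') ->
    forall i' j', (i' < n)%N -> (j' < n)%N ->
      rar (den P (rcons (rcons v i) j) p m') MAT (i' * n + j')%N =
      if (i' == i) && (j' == j) then B i j else rar m' MAT (i' * n + j')%N) ->
  forall i j, (i < n)%N -> (j < n)%N ->
    rar (den P v (For 0 (For 0 p)) m) MAT (i * n + j)%N = B i j.
Proof.
move=> v0 vn mA step.
pose I i (m' : memory R) := forall i' j', (i' < n)%N -> (j' < n)%N ->
  rar m' MAT (i' * n + j')%N = if (i' < i)%N then B i' j' else A i' j'.
have : I n (den P v (For 0 (For 0 p)) m).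
  apply: (forP (I := I)) => // i m1 hi F1 I1.
  pose J j (m' : memory R) := forall i' j', (i' < n)%N -> (j' < n)%N ->
    rar m' MAT (i' * n + j')%N =
    if (i' < i)%N || (i' == i) && (j' < j)%N then B i' j' else A i' j'.
  have : J n (den P (rcons v i) (For 0 p) m1).
    apply: (forP (I := J)) => [|i' j' hi' hj'|j m2 hj F2 J2 i' j' hi' hj'].
    - by rewrite nth_rcons v0.
    - by rewrite I1 // andbF orbF.
    rewrite step //; last exact: frame_trans F1 F2.
    rewrite J2 //; case: eqP => [->|ne]; case: eqP => [->|ne'];
      rewrite /= ?ltnn ?ltnSn ?eqxx //= ltnS.
    by have -> : (j' <= j)%N = (j' < j)%N by lia.
  by move=> Jn i' j' hi' hj'; rewrite Jn // hj' andbT ltnS [(i' <= i)%N]leq_eqVlt orbC.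
by move=> In i j hi hj; rewrite In // hi.
Qed.

Lemma fillmxP m (c := nar m CAP) (mu := rar m MUL) (sel := nar m SEL) : data m ->
  (forall e, (e < n)%N -> nar m ACT e = active n nv inc c sel e) ->
  forall e f, (e < n)%N -> (f < n)%N ->
  rar (den P env fillmx m) MAT (e * n + f)%N = flowmx n nv inc x c mu sel e f.
Proof.
move=> dm am; apply: (for2P (A := fun i j => rar m MAT (i * n + j)%N)) => //.
move=> i j m1 hi hj F1 _ i' j' hi' hj'.
rewrite den_then den_hr.
have d1 := data_frame F1 isT isT dm; have [f1 g1 _ _] := F1.
rewrite (nden_idx (i := i) (j := j) d1) //.
set m2 := setr m1 MAT _ _.
have d2 : data m2 by rewrite /m2; case: d1.
pose J k (m' : memory R) := forall i' j', (i' < n)%N -> (j' < n)%N ->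
  rar m' MAT (i' * n + j')%N = if (i' == i) && (j' == j) then
    (if active n nv inc c sel i && active n nv inc c sel j then
       \sum_(0 <= v < k) flow inc x c mu i j v else 0)
    else rar m1 MAT (i' * n + j')%N.
pose loop := (When (And (And (ifAct (Nv 3)) (ifAct (Nv 4)))
  (And (ifIn (Nv 5) (Nv 3)) (ifIn (Nv 5) (Nv 4)))) fillstep).
suff H : J nv (den P (rcons (rcons env i) j) (For 1 loop) m2).
  by rewrite -/loop H.
apply: (forP (I := J)) => // [{}i' {}j' {}hi' {}hj'|k m3 hk F3 J3 {}i' {}j' {}hi' {}hj'].
  by rewrite /= idx_inj // big_geq //; case: ifP => //; case: ifP.
have d3 := data_frame F3 isT isT d2; have [f3 g3 _ _] := F3.
set v := rcons (rcons (rcons env i) j) k.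
have Ea e t : (e < n)%N -> nden P v m3 t = e -> bden P v m3 (ifAct t) = active n nv inc c sel e.
  move=> he Et /=; rewrite Et f3 // -[nar m2]/(nar m1) f1 // am //.
  by case: active.
rewrite den_when !bden_and (Ea i (Nv 3)) // (Ea j (Nv 4)) //.
rewrite (bden_ifIn (v := k) (e := i) d3) // (bden_ifIn (v := k) (e := j) d3) //.
rewrite big_nat_recr // [flow _ _ _ _ _ _ k]/flow.
case: ifP => [/andP[aij inij]|h]; last first.
  rewrite J3 //; case: ifP => // _; case: ifP => // aij.
  by rewrite aij /= in h; rewrite h /= addr0.
have Emass t e : (e < n)%N -> nden P v m3 t = e -> rden P v m3 (mass (Nv 5) t) = x e * mu k.
  move=> he Et; rewrite [rden _ _ _ _]/= -[rlow _ _]/(rden P v m3 (Rlow t)).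
  by rewrite (rden_low d3 Et) // g3 // [rar m2 MUL]/= g1.
have Eres : rden P v m3 (residue (Nv 5) (Nv 3)) = (c k)%:R - x i * mu k.
  rewrite -(Emass (Nv 3) i) // /= f3 // -[nar m2]/(nar m1) f1 //.
have Emat : rden P v m3 (Mat (Nv 3) (Nv 4)) = \sum_(0 <= w < k) flow inc x c mu i j w.
  rewrite -[LHS]/(rar m3 MAT (nden P v m3 (idx (Nv 3) (Nv 4)))).
  by rewrite (nden_idx (i := i) (j := j) d3) // J3 // !eqxx aij.
rewrite aij /fillstep den_cond.
have -> : bden P v m3 (EqN (Nv 3) (Nv 4)) = (i == j) by rewrite /= eqn_leq.
case: ifP => ij; rewrite den_hr (nden_idx (i := i) (j := j) d3) //;
  set y := rden _ _ _ _;
  rewrite [rar (setr _ _ _ _) _ _]/= idx_inj //;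
  (case: ifP => E; last by rewrite J3 // E);
  rewrite inij /=.
- by rewrite -[y]/(rden P v m3 (Mat (Nv 3) (Nv 4)) -
    (1%:R - rden P v m3 (mass (Nv 5) (Nv 3)))) Emat (Emass (Nv 3) i).
- by rewrite -[y]/(rden P v m3 (Mat (Nv 3) (Nv 4)) +
    rden P v m3 (mass (Nv 5) (Nv 4)) * (1%:R - rden P v m3 (mass (Nv 5) (Nv 3)))
    / rden P v m3 (residue (Nv 5) (Nv 3))) Emat (Emass (Nv 3) i) // (Emass (Nv 4) j) // Eres.
Qed.


Lemma eliminateP m A : data m ->
  (forall i j, (i < n)%N -> (j < n)%N -> rar m MAT (i * n + j)%N = A i j) ->
  forall i j, (i < n)%N -> (j < n)%N ->
  rar (den P env eliminate m) MAT (i * n + j)%N = gauss n A i j.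
Proof.
move=> dm mA.
pose I t (m' : memory R) := forall i j, (i < n)%N -> (j < n)%N ->
  rar m' MAT (i * n + j)%N = gauss t A i j.
apply: (forP (I := I)) => // t m1 ht F1 I1.
have d1 := data_frame F1 isT isT dm.
apply: (for2P (A := gauss t A)) => // i j m2 hi hj F2 E2 i' j' hi' hj'.
have d2 := data_frame F2 isT isT d1.
(* Overwriting in place is safe: the update reads row t and column t, which this stage leaves alone,
   and the entry (i, j) itself, not yet updated. *)
have {}E2 k l : (k < n)%N -> (l < n)%N ->
    ~~ (t < k)%N || ~~ (t < l)%N || ((k == i) && (l == j)) ->
    rar m2 MAT (k * n + l)%N = gauss t A k l.
  move=> hk hl h; rewrite E2 //; case: ifP => // h' /=; rewrite /elim ifF //.
  by apply/negbTE; lia.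
pose v := rcons (rcons (rcons env t) i) j; rewrite den_when -/v.
have -> : bden P v m2 (And (LtN (Nv 3) (Nv 4)) (LtN (Nv 3) (Nv 5))) = (t < i)%N && (t < j)%N.
  by rewrite /= -!ltnNge.
case: ifP => h; last first.
  case: ifP => // /andP[/eqP-> /eqP->]; rewrite E2 ?eqxx ?orbT //=.
  by rewrite /elim h.
rewrite den_hr (nden_idx (i := i) (j := j) d2) //; set y := rden _ _ _ _.
rewrite [rar (setr _ _ _ _) _ _]/= idx_inj //; case: ifP => // _.
have EM a c k l : nden P v m2 a = k -> nden P v m2 c = l -> (k < n)%N ->
   rden P v m2 (Mat a c) = rar m2 MAT (k * n + l)%N.
  by move=> Ek El hk; rewrite -(nden_idx d2 Ek El).
rewrite -[y]/(rden P v m2 (Mat (Nv 4) (Nv 5)) -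
  rden P v m2 (Mat (Nv 4) (Nv 3)) * rden P v m2 (Mat (Nv 3) (Nv 5)) /
  rden P v m2 (Mat (Nv 3) (Nv 3))).
rewrite (EM (Nv 4) (Nv 5) i j) // (EM (Nv 4) (Nv 3) i t) // (EM (Nv 3) (Nv 5) t j) //.
rewrite (EM (Nv 3) (Nv 3) t t) // !E2 ?ltnn ?eqxx ?orbT //.
by rewrite /= /elim h.
Qed.

(** Hence a state has no mass before its turn, and [TOT] is kept current by adding the new mass. *)
Lemma bsub_low (ac : pred nat) F k i : (k <= n)%N -> (i < n - k)%N ->
  bsub n ac F k i = 0 :> R.
Proof.
elim: k i => [//|k IH] i hk hi; rewrite /= /bstep; case: ifP => _.
  by rewrite (_ : i == (n - k.+1)%N = false) //; lia.
by rewrite (_ : i == (n - k.+1)%N = false) ?IH //; lia.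
Qed.

Lemma backstepP (ac : pred nat) F p m k : data m ->
  (forall e, (e < n)%N -> nar m ACT e = ac e :> nat) ->
  (forall i j, (i < n)%N -> (j < n)%N -> rar m MAT (i * n + j)%N = F i j) ->
  (k < n)%N -> (forall i, (i < n)%N -> rar m PRB i = p i) ->
  rar m TOT 0%N = \sum_(0 <= i < n) p i -> p (n - k.+1)%N = 0 ->
  let m' := den P (rcons env k) backstep m in
  let p' := bstep n ac F (n - k.+1) p in
  (forall i, (i < n)%N -> rar m' PRB i = p' i) /\
  rar m' TOT 0%N = \sum_(0 <= i < n) p' i.
Proof.
move=> dm hac hF hk hp hT pk m' p'.
set q := (n - k.+1)%N in pk p' *; have qn : (q < n)%N by rewrite /q; lia.
set v := rcons env k in m' *.
pose m1 := den P v (Hr ACC Zero RZero) m.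
pose loop := For 0 (Hr ACC Zero (Radd (Ra ACC Zero)
      (Rmul (Ra PRB (Nv 4)) (Mat (Nv 4) pivot)))).
pose m2 := den P v loop m1.
have F1 : frame (Hr ACC Zero RZero) m m1 by exact: denF.
have d1 : data m1 := data_frame F1 isT isT dm.
have F2 : frame loop m1 m2 by exact: denF.
have d2 : data m2 := data_frame F2 isT isT d1.
have [f1 g1 _ _] := F1; have [f2 g2 _ _] := F2.
have E2 : rar m2 ACC 0%N = \sum_(0 <= i < n) p i * F i q.
  pose I i (m' : memory R) := rar m' ACC 0%N = \sum_(0 <= l < i) p l * F l q.
  apply: (forP (I := I)) => // [|i m3 hi F3 I3]; first by rewrite /I big_geq.
  have d3 := data_frame F3 isT isT d1; have [f3 g3 _ _] := F3.
  have Eq : nden P (rcons v i) m3 pivot = q by rewrite /= addn1.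
  rewrite /I -[LHS]/(rar m3 ACC 0%N + rar m3 PRB i *
    rar m3 MAT (nden P (rcons v i) m3 (idx (Nv 4) pivot))).
  rewrite (nden_idx (i := i) (j := q) d3) // I3 big_nat_recr //=.
  by rewrite !g3 // !g1 // hp // hF.
have Eq : nden P v m2 pivot = q by rewrite /= addn1.
have Emm : rden P v m2 (Mat pivot pivot) = F q q.
  rewrite -[LHS]/(rar m2 MAT (nden P v m2 (idx pivot pivot))).
  by rewrite (nden_idx (i := q) (j := q) d2) // g2 // g1 // hF.
pose B := And (ifAct pivot)
  (Or (LeR RZero (Mat pivot pivot)) (LeR (Ra TOT Zero) RZero)).
pose P1 := Seqs [:: For 0 (Hr PRB (Nv 4) RZero); Hr PRB pivot ROne; Hr TOT Zero ROne].
pose P2 := Seqs [:: Hr PRB pivot (Rsub RZero (Rdiv (Ra ACC Zero) (Mat pivot pivot)));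
                Hr TOT Zero (Radd (Ra TOT Zero) (Ra PRB pivot))].
have -> : m' = if bden P v m2 B then den P v P1 m2 else den P v P2 m2.
  by rewrite -den_cond.
have -> : bden P v m2 B = ac q && ((0 <= F q q) || (\sum_(0 <= i < n) p i <= 0)).
  rewrite bden_and; congr (_ && _).
    by rewrite /= addn1 f2 // f1 // hac //; case: (ac q).
  rewrite -[LHS]/(~~ (~~ (0 <= rden P v m2 (Mat pivot pivot)) && ~~ (rar m2 TOT 0%N <= 0))).
  by rewrite Emm g2 // g1 // hT negb_and !negbK.
rewrite /p' /bstep; case: ifP => _.
  pose m3 := den P v (For 0 (Hr PRB (Nv 4) RZero)) m2.
  have E3 i : (i < n)%N -> rar m3 PRB i = 0.
    pose I l (m' : memory R) := forall i, (i < l)%N -> rar m' PRB i = 0.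
    have : I n m3.
      apply: (forP (I := I)) => // l m4 hl F4 I4 i'.
      rewrite ltnS leq_eqVlt => /orP[/eqP->|h] /=; first by rewrite eqxx.
      by rewrite (ltn_eqF h) I4.
    exact.
  split=> [i hi|]; last first.
    rewrite /=; under eq_bigr do rewrite -[(_ == q)%:R]mulr1.
    by rewrite (sum_delta (fun=> 1)).
  by rewrite /P1 /= -/m3 addn1; case: eqP => // _; rewrite E3.
have Ep i : (i < n)%N -> rar m2 PRB i = p i by move=> hi; rewrite g2 // g1 // hp.
have -> : \sum_(0 <= i < n) p i * F i q = rden P v m2 (Ra ACC Zero) by rewrite -E2.
rewrite -Emm; set y := 0 - _.
have -> : den P v P2 m2 = den P v (Hr TOT Zero (Radd (Ra TOT Zero) (Ra PRB pivot)))
  (setr m2 PRB q y) by rewrite -Eq.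
split=> [i hi|] /=; first by case: eqP => // _; rewrite Ep.
rewrite addn1 eqxx g2 // g1 // hT.
rewrite [RHS](eq_bigr (fun i => (if i == q then y else p i) * 1)) => [|i _].
  by rewrite (sum_set (fun=> 1)) // mulr1; congr (_ + _); apply: eq_bigr => i _; rewrite mulr1.
by rewrite mulr1.
Qed.

Lemma backsubP (ac : pred nat) F m : data m ->
  (forall e, (e < n)%N -> nar m ACT e = ac e :> nat) ->
  (forall i j, (i < n)%N -> (j < n)%N -> rar m MAT (i * n + j)%N = F i j) ->
  let m' := den P env backsub m in let p := bsub n ac F n in
  (forall i, (i < n)%N -> rar m' PRB i = p i) /\
  rar m' TOT 0%N = \sum_(0 <= i < n) p i.
Proof.
move=> dm hac hF m' p.
pose m1 := den P env (For 0 (Hr PRB (Nv 3) RZero)) m.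
have F1 : frame (For 0 (Hr PRB (Nv 3) RZero)) m m1 by exact: denF.
have E1 i : (i < n)%N -> rar m1 PRB i = 0.
  pose I l (m' : memory R) := forall i, (i < l)%N -> rar m' PRB i = 0.
  have : I n m1.
    apply: (forP (I := I)) => // l m4 hl F4 I4 i'.
    rewrite ltnS leq_eqVlt => /orP[/eqP->|h] /=; first by rewrite eqxx.
    by rewrite (ltn_eqF h) I4.
  exact.
pose m2 := setr m1 TOT 0%N 0.
have F2 : frame backsub m m2.
  apply: (@frame_trans _ _ _ m1); first by case: F1 => h1 h2 h3 h4; split=> // a ha; apply: h2; move: ha; rewrite /= !inE !negb_or => /andP[].
  by split=> //= a; case: a.
pose I k (m' : memory R) := (forall i, (i < n)%N -> rar m' PRB i = bsub n ac F k i) /\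
  rar m' TOT 0%N = \sum_(0 <= i < n) bsub n ac F k i.
suff : I n (den P env (For 0 backstep) m2) by [].
apply: (forP (I := I)) => // [|k m3 hk F3 [I1 I2]].
  by split=> [i hi|] /=; [exact: E1|rewrite big1].
have F4 : frame backsub m m3.
  apply: frame_trans F2 _; case: F3 => h1 h2 h3 h4; split=> // a ha; apply: h2.
  by move: ha; rewrite /= !inE !negb_or => /andP[_ /andP[_]].
have [f4 g4 _ _] := F4.
apply: backstepP => //.
- exact: (data_frame F4 isT isT dm).
- by move=> e he; rewrite f4 // hac.
- by move=> i j hi hj; rewrite g4 // hF.
- by apply: bsub_low; lia.
Qed.


Definition accepted (m m' : memory R) e :=
  [/\ forall f, (f < n)%N -> nar m' SEL f = asel (nar m SEL) e f,
      forall v, (v < nv)%N -> nar m' CAP v = acap inc (nar m CAP) e v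
    & forall v, (v < nv)%N -> rar m' MUL v = amul inc x (nar m CAP) (rar m MUL) e v].

Lemma acceptP m e : data m -> (e < n)%N -> accepted m (den P (rcons env e) accept m) e.
Proof.
move=> dm he; set v := rcons env e.
rewrite /accept den_then; set p := For 1 _; set m1 := den P v (Hn SEL _ _) m.
have F1 : frame (Hn SEL (Nv 3) One) m m1 by exact: denF.
have d1 := data_frame F1 isT isT dm.
have [f1 g1 _ _] := F1.
pose I k (m' : memory R) := forall w, (w < nv)%N ->
  nar m' CAP w = (if (w < k)%N then acap inc (nar m CAP) e w else nar m CAP w) /\
  rar m' MUL w = (if (w < k)%N then amul inc x (nar m CAP) (rar m MUL) e w
                  else rar m MUL w).
have Inv : I nv (den P v p m1).
  apply: (forP (I := I)) => // k m2 hk F2 I2 w hw.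
  have d2 := data_frame F2 isT isT d1; have [f2 g2 _ _] := F2.
  rewrite den_when (bden_ifIn (v := k) (e := e) d2) //.
  have [c2 u2] := I2 k hk; rewrite ltnn in c2 u2.
  have [cw uw] := I2 w hw.
  rewrite ltnS leq_eqVlt; case: ifP => ik; last first.
    case: eqP => [->|_] /=; last by [].
    by rewrite c2 u2 /acap /amul ik.
  set y := rden P (rcons v k) m2 (Rdiv (Rmul (Ra MUL (Nv 4))
    (Rsub (Rn (Na CAP (Nv 4))) ROne)) (residue (Nv 4) (Nv 3))).
  have Ey : y = shrink (nar m CAP k) (rar m MUL k) (x e).
    rewrite -[y]/(rar m2 MUL k * ((nar m2 CAP k)%:R - 1%:R) /
      ((nar m2 CAP k)%:R - rden P (rcons v k) m2 (Rlow (Nv 3)) * rar m2 MUL k)).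
    by rewrite (rden_low (e := e) d2) // c2 u2.
  have -> : den P (rcons v k) (Then
       (Hr MUL (Nv 4) (Rdiv (Rmul (Ra MUL (Nv 4)) (Rsub (Rn (Na CAP (Nv 4))) ROne))
                            (residue (Nv 4) (Nv 3))))
       (Hn CAP (Nv 4) (Nsub (Na CAP (Nv 4)) One))) m2 =
     setn (setr m2 MUL k y) CAP k (nar m2 CAP k - 1)%N by [].
  rewrite /=; case: eqP => [->|_] /=; last by [].
  by rewrite c2 Ey /acap /amul ik.
have F3 : frame p m1 (den P v p m1) by exact: denF.
have [f3 _ _ _] := F3.
split=> [f hf|w hw|w hw]; last 2 first.
- by have [-> _] := Inv w hw; rewrite hw.
- by have [_ ->] := Inv w hw; rewrite hw.
by rewrite f3.
Qed.

Definition unchanged (m m' : memory R) :=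
  [/\ forall f, (f < n)%N -> nar m' SEL f = nar m SEL f,
      forall v, (v < nv)%N -> nar m' CAP v = nar m CAP v
    & forall v, (v < nv)%N -> rar m' MUL v = rar m MUL v].

Lemma accepted_unchanged m1 m2 m3 e : unchanged m1 m2 -> accepted m2 m3 e ->
  accepted m1 m3 e.
Proof.
move=> [s c u] [s' c' u']; split=> [f hf|v hv|v hv].
- by rewrite s' // /asel; case: eqP => // _; exact: s.
- by rewrite c' // /acap c.
- by rewrite u' // /amul c // u.
Qed.

(** The remainder locates u among the partial sums of p. The first alternative is the case where u
    exceeds every partial sum ending at an active edge. *)
Lemma selectP (ac : pred nat) p u m (m' := den P env select m)
    (cum := fun i => \sum_(0 <= j < i) p j) : data m ->
  (forall e, (e < n)%N -> nar m ACT e = ac e :> nat) ->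
  (forall e, ~~ ac e -> p e = 0) ->
  (forall e, (e < n)%N -> rar m PRB e = p e) ->
  rar m RND 0%N * rar m TOT 0%N = u ->
  unchanged m m' /\ (forall e, (e < n)%N -> ac e -> cum e.+1 < u) \/
  exists e, [/\ (e < n)%N, ac e, accepted m m' e, u <= cum e.+1 &
    forall f, (f < e)%N -> ac f -> cum f.+1 < u].
Proof.
move=> dm hac p0 hp hu.
pose m1 := setn (setr m REM 0%N u) FLAG 0%N 0%N.
pose I k (m' : memory R) :=
  [/\ nar m' FLAG 0%N = 0%N, rar m' REM 0%N = u - cum k, unchanged m m' &
    forall e, (e < k)%N -> ac e -> cum e.+1 < u] \/
  nar m' FLAG 0%N = 1%N /\ exists e, [/\ (e < k)%N, ac e, accepted m m' e,
    u <= cum e.+1 & forall f, (f < e)%N -> ac f -> cum f.+1 < u].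
set loop := For 0 (When (And (ifAct (Nv 3)) (LeN (Na FLAG Zero) Zero))
      (Cond (LeR (Ra REM Zero) (Ra PRB (Nv 3)))
         (Then (Hn FLAG Zero One) accept)
         (Hr REM Zero (Rsub (Ra REM Zero) (Ra PRB (Nv 3)))))).
have Em' : m' = den P env loop m1.
  by rewrite /m' /m1 -hu.
suff : I n m'.
  case=> [[_ _ h1 h2]|[_ h]]; [left|right] => //.
rewrite Em'; apply: (forP (I := I)) => // [|k m2 hk F2 I2].
  by left; split=> //=; rewrite /cum big_geq // subr0.
have d2 : data m2 := data_frame F2 isT isT (_ : data m1).
have [f2 g2 _ _] := F2.
have Ea : bden P (rcons env k) m2 (ifAct (Nv 3)) = ac k.
  by rewrite /= f2 //= hac //; case: (ac k).
rewrite den_when bden_and Ea.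
have -> : bden P (rcons env k) m2 (LeN (Na FLAG Zero) Zero) = (nar m2 FLAG 0%N == 0%N).
  by rewrite /= leqn0.
have cumS : cum k.+1 = cum k + p k by rewrite /cum big_nat_recr.
case: I2 => [[h1 h2 h3 h4]|[h1 [e [h2 h3 h4 h5 h6]]]]; last first.
  by rewrite h1 andbF; right; split=> //; exists e; split=> //; rewrite ltnS ltnW.
rewrite h1 eqxx andbT; case: ifP => [ak|/negbT ak]; last first.
  left; split=> //; first by rewrite cumS p0 // addr0.
  by move=> e; rewrite ltnS leq_eqVlt => /orP[/eqP->|]; [rewrite (negbTE ak)|exact: h4].
rewrite den_cond.
have -> : bden P (rcons env k) m2 (LeR (Ra REM Zero) (Ra PRB (Nv 3))) = (u <= cum k.+1).
  by rewrite /= h2 g2 //= hp // cumS lerBlDl.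
case: ifP => [hle|/negbT].
  right; set m3 := setn m2 FLAG 0%N 1%N.
  have -> : den P (rcons env k) (Then (Hn FLAG Zero One) accept) m2 =
     den P (rcons env k) accept m3 by [].
  have F3 : frame accept m3 (den P (rcons env k) accept m3) by exact: denF.
  have [f3 _ _ _] := F3; split; first by rewrite f3.
  exists k; split=> //.
  by apply: (accepted_unchanged (m2 := m3)) => //; apply: acceptP => //; case: d2.
rewrite -ltNge => hlt; left; split=> //=.
- by rewrite h2 g2 //= hp // cumS; ring.
- by move=> e; rewrite ltnS leq_eqVlt => /orP[/eqP->|]; [|exact: h4].
Qed.


Definition mgood (m : memory R) := good n nv inc x b (nar m CAP) (rar m MUL) (nar m SEL).

Lemma good_eq c mu sel c' mu' sel' :
  (forall f, (f < n)%N -> sel' f = sel f) ->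
  (forall v, (v < nv)%N -> c' v = c v) -> (forall v, (v < nv)%N -> mu' v = mu v) ->
  good n nv inc x b c mu sel -> good n nv inc x b c' mu' sel'.
Proof.
move=> s e u [h1 h2 h3 h4 h5]; split=> [f hf|v hv|v hv|v hv|v hv].
- by rewrite s // h1.
- by rewrite e // -(h2 v hv); congr (_ + _)%N; apply: eq_big_nat => f hf; rewrite s.
- by rewrite u // h3.
- by rewrite e // u // => /h4 ->.
- rewrite e //; apply: le_trans (h5 v hv); rewrite le_eqVlt; apply/orP; left.
  by apply/eqP; apply: eq_big_nat => f hf; rewrite /load s // u.
Qed.

Lemma potential_eq f c mu sel c' mu' sel' : (f < n)%N ->
  (forall f, (f < n)%N -> sel' f = sel f) ->
  (forall v, (v < nv)%N -> c' v = c v) -> (forall v, (v < nv)%N -> mu' v = mu v) ->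
  potential n nv inc x f c' mu' sel' = potential n nv inc x f c mu sel.
Proof.
move=> hf s e u; rewrite /potential /active /deficit s //.
have -> : all (fun v => inc v f ==> (0 < c' v)%N) (iota 0 nv) =
          all (fun v => inc v f ==> (0 < c v)%N) (iota 0 nv).
  by apply: eq_in_all => v; rewrite mem_iota => hv; rewrite e.
rewrite (_ : \sum_(0 <= v < nv) (if inc v f then 1 - mu' v else 0) =
  \sum_(0 <= v < nv) (if inc v f then 1 - mu v else 0)) //.
by apply: eq_big_nat => v hv; rewrite u.
Qed.

Hypothesis x01 : forall e, (e < n)%N -> 0 <= x e <= 1.

Definition act_of (m : memory R) := active n nv inc (nar m CAP) (nar m SEL).

Definition mpotential f (m : memory R) :=
  potential n nv inc x f (nar m CAP) (rar m MUL) (nar m SEL).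

(** The law p is chosen before u, so the set of draws leading to e contains an interval of known
    length. Draws outside these intervals, such as u = 0, still lead to a good memory. *)
Lemma roundP m : data m -> mgood m -> exists p : nat -> R,
  [/\ forall e, 0 <= p e,
      forall e, ~~ act_of m e -> p e = 0,
      forall f, (f < n)%N -> \sum_(0 <= e < n) p e *
        flowmx n nv inc x (nar m CAP) (rar m MUL) (nar m SEL) e f <= 0,
      forall f, act_of m f -> 0 < \sum_(0 <= e < n) p e
    & forall u, let m' := den P env round (setr m RND 0%N u) in
      let cum i := \sum_(0 <= j < i) p j in
      [/\ data m',
          unchanged m m' \/ exists2 e, act_of m e & accepted m m' e
        & forall e, act_of m e -> cum e < u * cum n <= cum e.+1 ->
            accepted m m' e]].
Proof.
move=> dm gm; set ac := act_of m.
set A := flowmx n nv inc x (nar m CAP) (rar m MUL) (nar m SEL).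
have [||| p0 pa pA pS] := @probP R n ac A.
- by move=> i j hi hj ij; exact: (flowmx_ge0 x01 gm).
- by move=> i hi; exact: (flowmx_sum x01 gm).
- by move=> i j; apply: flowmx_act.
exists (prob n ac A); split=> //.
  by move=> f af; apply: (pS f) => //; case/and3P: af.
move=> u m' cum.
pose m0 := setr m RND 0%N u.
pose m1 := den P env mark m0; pose m2 := den P env fillmx m1.
pose m3 := den P env eliminate m2; pose m4 := den P env backsub m3.
have Em' : m' = den P env select m4 by [].
have d0 : data m0 by case: dm.
have F1 : frame mark m0 m1 by exact: denF.
have F2 : frame fillmx m1 m2 by exact: denF.
have F3 : frame eliminate m2 m3 by exact: denF.
have F4 : frame backsub m3 m4 by exact: denF.
have F5 : frame select m4 m' by exact: denF.
have d1 := data_frame F1 isT isT d0.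
have d2 := data_frame F2 isT isT d1.
have d3 := data_frame F3 isT isT d2.
have d4 := data_frame F4 isT isT d3.
have d5 := data_frame F5 isT isT d4.
have [f1 g1 _ _] := F1; have [f2 g2 _ _] := F2.
have [f3 g3 _ _] := F3; have [f4 g4 _ _] := F4.
have A1 e : (e < n)%N -> nar m1 ACT e = ac e.
  by move=> he; apply: markP => //; case: gm.
have A2 e f : (e < n)%N -> (f < n)%N -> rar m2 MAT (e * n + f)%N = A e f.
  have := @fillmxP m1 d1; rewrite (f1 CAP) // (f1 SEL) // (g1 MUL) //; exact.
have A3 e f : (e < n)%N -> (f < n)%N -> rar m3 MAT (e * n + f)%N = gauss n A e f.
  exact: eliminateP.
have [A4 S4] : (forall i, (i < n)%N -> rar m4 PRB i = prob n ac A i) /\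
    rar m4 TOT 0%N = \sum_(0 <= i < n) prob n ac A i.
  apply: backsubP => //; first by move=> e he; rewrite f3 // f2 // A1.
have U4 : unchanged m m4.
  by split=> i hi; rewrite ?f4 ?f3 ?f2 ?f1 ?g4 ?g3 ?g2 ?g1.
have [] // := @selectP ac (prob n ac A) (u * cum n) m4.
- by move=> e he; rewrite f4 // f3 // f2 // A1.
- by rewrite S4 g4 // g3 // g2 // g1.
- rewrite -Em' => -[[s4 c4 u4] h]; split=> //.
    case: U4 => s c v; left; split=> i hi; [rewrite s4 // s|rewrite c4 // c|rewrite u4 // v] => //.
  move=> e ae /andP[_ h2]; have he : (e < n)%N by case/and3P: ae.
  by have := h e he ae; rewrite -/(cum e.+1) ltNge h2.
- rewrite -Em' => -[e [he ae acc h1 h2]].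
  have acc' := accepted_unchanged U4 acc; split=> //; first by right; exists e.
  move=> f af /andP[h3 h4]; suff -> : f = e by [].
  have cum_le i j : (i <= j)%N -> cum i <= cum j.
    move=> ij; rewrite /cum (big_cat_nat (n := i) (p := j)) //= lerDl sumr_ge0 //.
  have [lt|lt|//] := ltngtP f e.
    by have := lt_le_trans (h2 f lt af) h4; rewrite ltxx.
  by have := le_lt_trans (le_trans h1 (cum_le e.+1 f lt)) h3; rewrite ltxx.
Qed.

Lemma accepted_good m m' e : mgood m -> act_of m e -> accepted m m' e -> mgood m'.
Proof.
move=> gm ae [s c u]; exact: good_eq s c u (good_accept x01 gm ae).
Qed.

Lemma unchanged_good m m' : mgood m -> unchanged m m' -> mgood m'.
Proof. by move=> gm [s c u]; exact: good_eq s c u gm. Qed.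

(** Cell 0 is left out because it holds the base address during the copy. *)
Lemma copyoutP v (m : memory R) i : nth 0%N v 0 = n -> size v = 2%N -> (0 < i < n)%N ->
  nlow (den P v copyout m) i = nar m SEL i.
Proof.
move=> vn sv hi.
pose I k (m' : memory R) := forall i, (0 < i < k)%N -> nlow m' i = nar m SEL i.
have : I n (den P v copyout m).
  apply: (forP (I := I)) => // [l /andP[h1 h2]|k m1 hk F1 I1 l hl]; first lia.
  have [f1 _ _ _] := F1; rewrite /= /out nth_rcons sv /= f1 //.
  case: ifP => h /=; last first.
    rewrite I1 //; lia.
  rewrite /update; case: eqP => [->//|ne]; apply: I1; lia.
by apply.
Qed.

Lemma setupP (m : memory R) : (forall v e, (v < nv)%N -> (e < n)%N -> nlow m (2 + (v * n + e))%N = inc v e) ->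
  (forall e, (e < n)%N -> rlow m e = x e) ->
  (forall v, (v < nv)%N -> nlow m (2 + (nv * n + v))%N = b v) ->
  nar m OFF 0%N = 0%N -> (forall e, nar m SEL e = 0%N) ->
  let m' := den P [:: n; nv] setup m in
  [/\ data m', forall e, nar m' SEL e = 0%N,
      forall v, (v < nv)%N -> nar m' CAP v = b v
    & forall v, (v < nv)%N -> rar m' MUL v = 1].
Proof.
move=> h1 h2 h4 h5 h6 m'.
pose v := [:: n; nv].
pose loop := Then
      (Hn CAP (Nv 2) (Nlow (Nadd (Nc 2) (Nadd (Na OFF NV) (Nv 2)))))
      (Hr MUL (Nv 2) ROne).
pose m1 := den P v (For 1 table) m; pose m2 := den P v (For 0 table) m1.
have F1 : frame table m m1 by exact: (denF P (For 1 table)).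
have F2 : frame table m1 m2 by exact: (denF P (For 0 table)).
have T1 : forall j, (j <= nv)%N -> nar m1 OFF j = (j * n)%N.
  pose I k (m' : memory R) := forall j, (j <= k)%N -> nar m' OFF j = (j * n)%N.
  apply: (forP (I := I)) => // [j|k m3 hk F3 I3 j hj]; first by rewrite leqn0 => /eqP->.
  rewrite /= addn1 I3 //; case: eqP => [->|ne]; first by rewrite mulSn addnC.
  apply: I3; lia.
(* Where the two ranges overlap, the second pass rewrites the same values. *)
have T2 : (forall j, (j <= nv)%N -> nar m2 OFF j = (j * n)%N) /\
          (forall j, (j <= n)%N -> nar m2 OFF j = (j * n)%N).
  pose I k (m' : memory R) := (forall j, (j <= nv)%N -> nar m' OFF j = (j * n)%N) /\
    (forall j, (j <= k)%N -> nar m' OFF j = (j * n)%N).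
  apply: (forP (I := I)) => // [|k m3 hk F3 [I3 I4]].
    by split=> // j; rewrite leqn0 => /eqP->; rewrite T1.
  split=> j hj /=; rewrite addn1 I4 //;
    (case: eqP => [->|ne]; first by rewrite mulSn addnC);
    [exact: I3|apply: I4; lia].
have [T3 T4] := T2.
have F3 : frame loop m2 m' by exact: (denF P (For 1 loop)).
have [f1 g1 r1 l1] := F1; have [f2 g2 r2 l2] := F2; have [f3 g3 r3 l3] := F3.
have d2 : data m2.
  split=> [w e hw he|e he|j /orP[hj|hj]].
  - by rewrite l2 // l1 // h1.
  - by rewrite r2 r1 h2.
  - by apply: T3; exact: ltnW.
  - by apply: T4; exact: ltnW.
have C : forall w, (w < nv)%N -> nar m' CAP w = b w /\ rar m' MUL w = 1.
  pose I k (m' : memory R) := forall w, (w < k)%N -> nar m' CAP w = b w /\ rar m' MUL w = 1.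
  suff : I nv (den P v (For 1 loop) m2) by [].
  apply: (forP (I := I)) => // k m3 hk F4 I4 w hw /=.
  have [f4 _ _ l4] := F4.
  case: eqP => [->|ne]; last by apply: I4; lia.
  split=> //; rewrite f4 // T3 // l4 // l2 // l1 // (minn_idPl _) ?h4 //; lia.
split=> [|e|w hw|w hw].
- exact: data_frame F3 isT isT d2.
- by rewrite f3 // f2 // f1.
- by case: (C w hw).
- by case: (C w hw).
Qed.

End Spec.

(** * Lower bounds for the law of the random tape *)

Section Prob.
Variable R : realType.
Implicit Types (Y : set (seq R)).
Local Notation I01 := (`[0%R, 1%R]%classic : set R).
Local Notation leb := (@lebesgue_measure R).

(** Events on sequences, so that tapes can be cut and extended without casts between tuple types. *)
Definition prob_tape N Y : \bar R :=
  @tape_prob R N [set t | Y (tval t)].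

Lemma prob_tapeS N Y :
  prob_tape N.+1 Y = (\int[leb]_(u in I01) prob_tape N [set t | Y (u :: t)])%E.
Proof. by []. Qed.

Lemma prob_tape0 Y : prob_tape 0 Y = (\1_Y [::])%:E.
Proof. by []. Qed.

Lemma prob_tape_ge0 N Y : (0 <= prob_tape N Y)%E.
Proof.
elim: N Y => [|N IH] Y; first by rewrite prob_tape0 lee_fin.
by rewrite prob_tapeS; apply: integral_ge0 => u _; exact: IH.
Qed.

Lemma leb01 : leb I01 = 1%E.
Proof. by rewrite lebesgue_measure_itv /= lte_fin ltr01 oppr0 adde0. Qed.

Lemma integral01_cst (y : \bar R) : (\int[leb]_(u in I01) y = y)%E.
Proof.
rewrite -[X in (X = _)%E]/(\int[leb]_(u in I01) (cst y) u)%E.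
by rewrite integral_cst /= ?leb01 ?mule1.
Qed.

Lemma prob_tape_all N Y : (forall t, size t = N -> Y t) -> prob_tape N Y = 1%E.
Proof.
elim: N Y => [|N IH] Y h; first by rewrite prob_tape0 indicE mem_set //; exact: h.
rewrite prob_tapeS -[RHS]integral01_cst; apply: eq_integral => u _.
by apply: IH => t ht; apply: h; rewrite /= ht.
Qed.

Lemma eq_prob_tape N Y Y' : (forall t, size t = N -> Y t <-> Y' t) ->
  prob_tape N Y = prob_tape N Y'.
Proof.
move=> h; congr tape_prob; apply/funext => t; apply/propext; apply: h.
exact: size_tuple.
Qed.

Lemma prob_tape_drop k N Y :
  prob_tape (k + N) [set t | Y (drop k t)] = prob_tape N Y.
Proof.
elim: k => [|k IH]; first by apply: eq_prob_tape => t _; rewrite /= drop0.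
rewrite addSn prob_tapeS -[RHS]integral01_cst; apply: eq_integral => u _.
by rewrite -IH.
Qed.

Lemma prob_tape_skip N Y Y' : (forall u t, size t = N -> Y (u :: t) <-> Y' t) ->
  prob_tape N.+1 Y = prob_tape N Y'.
Proof.
move=> h; rewrite prob_tapeS -[RHS]integral01_cst; apply: eq_integral => u _.
by apply: eq_prob_tape => t; exact: h.
Qed.

Lemma steps_foldl c s k s' l (t : seq R) : steps c s k s' -> (k <= size t)%N ->
  foldl (@step R) (c :: l, s) t = foldl (@step R) (l, s') (drop k t).
Proof.
move=> H hk; rewrite -{1}(cat_take_drop k t) foldl_cat H // size_take.
by case: ltnP => //; lia.
Qed.

(** The coordinates consumed by deterministic code are integrated out with total mass 1. *)
Lemma prob_tape_steps c s k s' l N (X : set (config R)) : steps c s k s' ->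
  (k <= N)%N -> prob_tape N [set t | X (foldl (@step R) (c :: l, s) t)] =
  prob_tape (N - k) [set t | X (foldl (@step R) (l, s') t)].
Proof.
move=> H hk; rewrite -[RHS](prob_tape_drop k) subnKC //; apply: eq_prob_tape => t ht.
by rewrite /= (steps_foldl _ H) // ht.
Qed.

(** The integral of a nonnegative function is a supremum over simple functions below it, hence
    monotone without measurability. *)
Lemma ge0_le_integral_nonmeasurable (f g : R -> \bar R) (D : set R) :
  (forall u, D u -> (0 <= f u)%E) -> (forall u, D u -> (f u <= g u)%E) ->
  (\int[leb]_(u in D) f u <= \int[leb]_(u in D) g u)%E.
Proof.
move=> f0 fg; have g0 u : D u -> (0 <= g u)%E.
  by move=> Du; exact: le_trans (f0 u Du) (fg u Du).
rewrite !ge0_integralE //; apply: ereal_sup_le => _ [h hf <-]; exists h => // u.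
apply: le_trans (hf u) _; rewrite /patch; case: ifP => // /set_mem Du; exact: fg.
Qed.

(** Only the minorizing step function has to be measurable. The intervals are open on the left, as
    in the selection rule, and thus disjoint. *)
Lemma integral01_ge_step (F : R -> \bar R) (a y : nat -> R) n :
  (forall u, (0 <= F u)%E) -> (forall e, 0 <= y e) -> 0 <= a 0%N ->
  (forall i j, (i <= j)%N -> a i <= a j) -> a n <= 1 ->
  (forall e u, (e < n)%N -> a e < u <= a e.+1 -> ((y e)%:E <= F u)%E) ->
  ((\sum_(0 <= e < n) y e * (a e.+1 - a e))%:E <=
   \int[leb]_(u in I01) F u)%E.
Proof.
move=> F0 y0 a0 am an hF.
pose A e : set R := `]a e, a e.+1]%classic.
pose g u : \bar R := (\sum_(0 <= e < n) (y e)%:E * (\1_(A e) u)%:E)%E.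
have mA e : measurable (A e) by exact: measurable_itv.
apply: (@le_trans _ _ (\int[leb]_(u in I01) g u)%E); last first.
  apply: ge0_le_integral_nonmeasurable => u _.
    by apply: sume_ge0 => e _; rewrite mule_ge0 // lee_fin.
  have [[e he ue]|nu] := pselect (exists2 e, (e < n)%N & a e < u <= a e.+1).
    apply: le_trans (hF e u he ue); rewrite /g.
    rewrite (bigD1_seq e) ?mem_index_iota ?iota_uniq //= indicE mem_set; last first.
      by rewrite /A /= in_itv.
    rewrite mule1 big1_seq ?adde0 // => i /andP[ie]; rewrite mem_index_iota => hi.
    rewrite indicE memNset ?mule0 // /A /= in_itv /= => /andP[u1 u2].
    case/andP: ue => u3 u4; case: (ltngtP i e) ie => // lt _.
      by have := lt_le_trans u3 (le_trans u2 (am i.+1 e lt)); rewrite ltxx.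
    by have := lt_le_trans u1 (le_trans u4 (am e.+1 i lt)); rewrite ltxx.
  rewrite /g big1_seq // => i /andP[_]; rewrite mem_index_iota => hi.
  rewrite indicE memNset ?mule0 // /A /= in_itv /= => ui; apply: nu; exists i => //.
rewrite /g ge0_integral_sum //=; last 2 first.
- move=> e; apply: measurable_funeM; apply/measurable_EFinP.
  by apply: measurable_indic; exact: mA.
- by move=> e u _; apply: mule_ge0; rewrite lee_fin // indicE ler0n.
rewrite -sumEFin !big_nat; apply: lee_sum => e he.
rewrite ge0_integralZl //=; last 2 first.
- by apply/measurable_EFinP; apply: measurable_indic; exact: mA.
- by rewrite lee_fin.
have mI : (R.-ocitv.-measurable).-sigma.-measurable I01 by exact: measurable_itv.
rewrite (integral_indic _ mI); last exact: mA.
rewrite EFinM lee_wpmul2l ?lee_fin //.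
have -> : A e `&` I01 = A e.
  apply/setIidPl => u; rewrite /A /= !in_itv /= => /andP[u1 u2].
  have u0 : 0 < u := le_lt_trans (le_trans a0 (am 0%N e (leq0n e))) u1.
  by rewrite (ltW u0) (le_trans u2 (le_trans (am e.+1 n he) an)).
rewrite -[X in (_ <= X)%E]/(leb (A e)) /A lebesgue_measure_itv /= lte_fin; case: ltP => h //.
rewrite lee_fin subr_le0 //.
Qed.

End Prob.

(** * The algorithm on the real RAM *)

Definition incr (a : nexp) : cmd := SetN a (NAdd (NLoad a) (NConst 1)).
(** Passage from a real to an integer by repeated comparison, in time linear in the value. *)
Definition count_to (e : rexp) (a : nexp) : cmd :=
  While (BNot (BLeR e (RNat (NLoad a)))) (incr a).

Definition nE2 : nexp := NAdd (NLoad (NConst 1)) (NLoad (NConst 1)).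

(* Programs have no integer multiplication, so the size of the input matrix is
   computed as a real; counting up to it turns cell 0, which contained |V|, into
   a pointer to free memory. *)
Definition prelude : cmd :=
  Seq (SetR nE2 (RNat (NLoad (NConst 0))))
 (Seq (SetR (NAdd nE2 (NConst 1))
        (RAdd (RMul (RNat (NLoad (NConst 0))) (RNat (NLoad (NConst 1))))
              (RNat (NAdd (NLoad (NConst 0)) (NAdd nE2 (NConst 4))))))
 (Seq (count_to (RLoad (NAdd nE2 (NConst 1))) (NConst 0))
 (Seq (SetN (ctr 0) (NLoad (NConst 1)))
      (count_to (RLoad nE2) (ctr 1))))).

Definition main_body : cmd :=
  Seq (RandR (cell (rcode RND) (NConst 0)))
      (Seq (compile 3 round) (SetN (ctr 2) (NAdd (NLoad (ctr 2)) (NConst 1)))).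

Definition main_loop : cmd :=
  While (ltN (NLoad (ctr 2)) (NLoad (ctr 0))) main_body.

(** Cell 0 is written last, since every array access goes through it. *)
Definition finish : cmd :=
  Seq (compile 2 copyout) (SetN (NConst 0) (NLoad (cell (ncode SEL) (NConst 0)))).

Definition algorithm : cmd :=
  Seq prelude (Seq (compile 2 setup) (Seq (SetN (ctr 2) (NConst 0))
    (Seq main_loop finish))).

Section Machine.
Variables (R : realType) (n nv : nat) (inc : nat -> nat -> bool).
Variables (x : nat -> R) (b : nat -> nat).
Implicit Types (s : state R) (m : memory R).

(** Lies above the integer input, of length 2 + nv n + nv, and above the real scratch cells 2n and
    2n + 1 that follow x and w. *)
Let P := (nv * n + (nv + (n + n + 4)))%N.

Lemma P_big : (nv * n + nv + n + 4 <= P)%N. Proof. by rewrite /P; lia. Qed.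
Lemma P_gt0 : (0 < P)%N. Proof. by rewrite /P; lia. Qed.

Lemma count_toP (e : rexp) (a : nexp) s A K :
  (forall j, let s' := State (update (nmem s) A j) (rmem s) in
     neval s' a = A /\ reval s' e = K%:R) ->
  (nmem s A <= K)%N ->
  steps (count_to e a) s (2 * (K - nmem s A) + 1)
    (State (update (nmem s) A K) (rmem s)).
Proof.
move=> h hK.
have upd j j' : update (update (nmem s) A j) A j' = update (nmem s) A j'.
  by apply/funext => i; rewrite /update; case: eqP.
have ld j : neval (State (update (nmem s) A j) (rmem s)) (NLoad a) = j.
  by rewrite /= (proj1 (h j)) /update eqxx.
have main d : forall j, (j + d = K)%N ->
    steps (count_to e a) (State (update (nmem s) A j) (rmem s)) (2 * d + 1)
      (State (update (nmem s) A K) (rmem s)).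
  elim: d => [|d IH] j hj.
    rewrite addn0 in hj; rewrite -hj; apply: steps_while_false.
    rewrite -[beval _ _]/(~~ (reval _ e <= (neval _ (NLoad a))%:R)).
    by rewrite (proj2 (h j)) ld negbK hj lexx.
  have -> : (2 * d.+1 + 1 = 1 + 1 + (2 * d + 1))%N by lia.
  apply: (steps_while_true (s1 := State (update (nmem s) A j.+1) (rmem s))).
  - rewrite -[beval _ _]/(~~ (reval _ e <= (neval _ (NLoad a))%:R)).
    by rewrite (proj2 (h j)) ld ler_nat -ltnNge; lia.
  - apply: steps1 => k u; rewrite -[LHS]/(k, State (update (update (nmem s) A j)
      (neval (State (update (nmem s) A j) (rmem s)) a)
      (neval (State (update (nmem s) A j) (rmem s)) (NLoad a) + 1)%N) (rmem s)).
    by rewrite (proj1 (h j)) ld upd addn1.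
  - by apply: IH; lia.
have Es : s = State (update (nmem s) A (nmem s A)) (rmem s).
  case: s {h hK upd ld main} => f g /=; congr State.
  by apply/funext => i; rewrite /update; case: eqP => [->|].
by rewrite {1}Es; apply: main; lia.
Qed.

Lemma neval_base s e c : neval s (cell c e) = (nmem s 0%N + 8 * neval s e + c)%N.
Proof. by rewrite /=; lia. Qed.

Lemma preludeP s :
  nmem s 0%N = nv -> nmem s 1%N = n ->
  (forall j, (2 + (nv * n + nv) <= j)%N -> nmem s j = 0%N) ->
  exists k s' m, (k <= 2 * P + 2 * nv + 20)%N /\ [/\ steps prelude s k s',
    rep P s' [:: n; nv] m,
    forall j, (0 < j < P)%N -> nlow m j = nmem s j,
    forall a i, nar m a i = 0%N
    & forall j, (j < n)%N -> rlow m j = rmem s j].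
Proof.
move=> h0 h1 hz.
pose r1 := update (rmem s) (n + n)%N nv%:R.
pose r2 := update r1 (n + n + 1)%N (P%:R : R).
pose s1 := State (nmem s) r1; pose s2 := State (nmem s) r2.
pose s3 := State (update (nmem s) 0 P) r2.
pose s4 := State (update (nmem s3) P n) r2.
pose s5 := State (update (nmem s4) (P + 8)%N nv) r2.
have P4 : (4 <= P)%N by rewrite /P; lia.
have n2P : (n + n + 1 < P)%N by rewrite /P; lia.
have S1 : steps (SetR nE2 (RNat (NLoad (NConst 0)))) s 1 s1.
  by apply: steps1 => k u; rewrite /= h0 h1.
have S2 : steps (SetR (NAdd nE2 (NConst 1))
        (RAdd (RMul (RNat (NLoad (NConst 0))) (RNat (NLoad (NConst 1))))
              (RNat (NAdd (NLoad (NConst 0)) (NAdd nE2 (NConst 4)))))) s1 1 s2.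
  by apply: steps1 => k u; rewrite /= h0 h1 -natrM -natrD.
have S3 : steps (count_to (RLoad (NAdd nE2 (NConst 1))) (NConst 0)) s2
    (2 * (P - nmem s2 0) + 1) s3.
  apply: count_toP => [j|] /=; last by rewrite h0 /P; lia.
  by split=> //; rewrite /update /= h1 /r2 /update eqxx.
have S4 : steps (SetN (ctr 0) (NLoad (NConst 1))) s3 1 s4.
  apply: steps1 => k u; rewrite -[LHS]/(k, State (update (nmem s3)
    (neval s3 (ctr 0)) (nmem s3 1%N)) r2) neval_base.
  have -> : (nmem s3 0 + 8 * neval s3 (NConst 0) + 0 = P)%N by rewrite /= /update /=; lia.
  by have -> : nmem s3 1%N = n by [].
(* Cell 0 no longer contains |V|; it is recovered from the real copy at 2n by counting from 0, the
   content of fresh memory. *)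
have S5 : steps (count_to (RLoad nE2) (ctr 1)) s4 (2 * (nv - nmem s4 (P + 8)%N) + 1) s5.
  apply: count_toP => [j s'|].
    have C0 : nmem s' 0%N = P.
      by rewrite -[LHS]/(if 0%N == (P + 8)%N then j else if 0%N == P then n else P) !ifF //; lia.
    have C1 : nmem s' 1%N = n.
      by rewrite -[LHS]/(if 1%N == (P + 8)%N then j else if 1%N == P then n else nmem s 1%N)
        !ifF //; lia.
    split; first by rewrite neval_base C0 /=; lia.
    rewrite -[LHS]/(r2 (nmem s' 1 + nmem s' 1)%N) C1 /r2 /r1 /update eqxx ifF //; lia.
  rewrite /= /update /=; have -> : (P + 8 == P)%N = false by lia.
  have -> : (P + 8 == 0)%N = false by lia.
  by rewrite hz // /P; lia.
pose m := Memory (nmem s5) (rmem s5) (fun _ _ => 0%N)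
  (fun a i => rmem s5 (P + 8 * i + rcode a)%N).
have E5 j : nmem s5 j = if j == (P + 8)%N then nv else if j == P then n else
   if j == 0%N then P else nmem s j by [].
exists (1 + 1 + (1 + 1 + (1 + (2 * (P - nmem s2 0) + 1) +
  (1 + 1 + (2 * (nv - nmem s4 (P + 8)%N) + 1)))))%N, s5, m; split; first lia.
split=> //.
- apply: (steps_seq S1); apply: (steps_seq S2); apply: (steps_seq S3).
  exact: (steps_seq S4 S5).
- split=> //.
  + by rewrite E5 !ifF //; lia.
  + move=> [|[|k]] // _; rewrite E5.
      by rewrite muln0 addn0 eqxx ifF //; lia.
    by rewrite muln1 eqxx.
  + move=> a i; have ha : (0 < ncode a < 8)%N by case: a.
    rewrite E5 !ifF ?hz //; rewrite /P; lia.
- by move=> j hj; rewrite -[LHS]/(nmem s5 j) E5 !ifF //; lia.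
- by move=> j hj; rewrite /m /= /r2 /r1 /update !ifF //; lia.
Qed.

Hypothesis x01 : forall e, (e < n)%N -> 0 <= x e <= 1.

Let data := data n nv inc x.
Let mgood := mgood n nv inc x b.
(** Besides the compiled round, an iteration takes the loop test, two [Seq], the draw and the
    counter update: 5 steps, with one to spare. *)
Let K := (cost P round + 6)%N.
Let D := (cost P copyout + 4)%N.

Lemma finishP s r m : rep P s [:: n; nv; r] m ->
  exists k s', [/\ (k < D)%N, steps finish s k s' &
    forall e, (e < n)%N -> nmem s' e = nar m SEL e].
Proof.
move=> Rs; have nP : (n <= P)%N by rewrite /P; lia.
have Rs' : rep P s [:: n; nv] m by exact: (rep_rcons P_gt0 (v := [:: n; nv]) (i := r)).
have vP : all (leq^~ P) [:: n; nv] by rewrite /= nP /P; lia.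
have [k [s1 [hk S1 R1]]] := compileP P_gt0 copyout Rs' vP.
have [h0 hl _ hn _] := R1.
have [f1 _ _ _] := denF P copyout [:: n; nv] m.
pose s2 := State (update (nmem s1) 0%N (nar m SEL 0%N)) (rmem s1).
exists (1 + k + 1)%N, s2; split=> [||e he].
- by rewrite /D; lia.
- apply: (steps_seq S1); apply: steps1 => l u.
  rewrite -[LHS]/(l, State (update (nmem s1) 0%N
     (nmem s1 (neval s1 (cell (ncode SEL) (NConst 0))))) (rmem s1)).
  by rewrite (neval_cell _ _ R1) hn f1.
- rewrite /s2 /= /update; case: eqP => [->//|/eqP e0].
  rewrite (proj1 (hl e _)); last by lia.
  by apply: (copyoutP P_big) => //; lia.
Qed.

Lemma main_test s r m : rep P s [:: n; nv; r] m ->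
  beval s (ltN (NLoad (ctr 2)) (NLoad (ctr 0))) = (r < n)%N.
Proof.
move=> Rs.
rewrite -[LHS]/(~~ (neval s (NLoad (ctr 0)) <= neval s (NLoad (ctr 2)))%N).
by rewrite !(neval_load_ctr Rs) // -ltnNge.
Qed.

Lemma main_roundP s r m u : (r < n)%N -> rep P s [:: n; nv; r] m ->
  exists k s', [/\ (k + 3 <= K)%N,
    steps (Seq (compile 3 round) (SetN (ctr 2) (NAdd (NLoad (ctr 2)) (NConst 1))))
      (State (nmem s) (update (rmem s) P u)) k s' &
    rep P s' [:: n; nv; r.+1] (den P [:: n; nv; r] round (setr m RND 0%N u))].
Proof.
move=> hr Rs.
have := rep_setr P_gt0 RND 0%N u Rs; rewrite muln0 !addn0 => Ru.
have vP : all (leq^~ P) [:: n; nv; r] by rewrite /= /P; lia.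
have [k [s1 [hk S1 R1]]] := compileP P_gt0 round Ru vP.
set m1 := den _ _ _ _ in R1 *.
have R2 := rep_ctr P_gt0 r.+1 (rep_rcons P_gt0 (v := [:: n; nv]) (i := r) R1).
exists (1 + k + 1)%N; eexists; split; [by rewrite /K; lia| |exact: R2].
apply: (steps_seq S1); apply: steps1 => l v.
rewrite -[LHS]/(l, State (update (nmem s1) (neval s1 (ctr 2))
  (neval s1 (NLoad (ctr 2)) + 1)%N) (rmem s1)).
by rewrite (neval_ctr _ R1) (neval_load_ctr R1) // addn1.
Qed.

Let loop s : config R := ([:: main_loop; finish], s).

(** The loop test and a [Seq] use up [u0] and [u1]; the third number is the one stored. *)
Lemma main_step s r m u0 u1 u (t : seq R) : (r < n)%N -> rep P s [:: n; nv; r] m ->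
  foldl (@step R) (loop s) [:: u0, u1, u & t] =
  foldl (@step R) ([:: Seq (compile 3 round)
      (SetN (ctr 2) (NAdd (NLoad (ctr 2)) (NConst 1))); main_loop; finish],
    State (nmem s) (update (rmem s) P u)) t.
Proof.
move=> hr Rs; rewrite -[LHS]/(foldl (@step R) (step (step (step (loop s) u0) u1) u) t).
have -> : step (loop s) u0 = ([:: main_body; main_loop; finish], s).
  rewrite -[LHS]/(if beval s (ltN (NLoad (ctr 2)) (NLoad (ctr 0)))
    then ([:: main_body; main_loop; finish], s) else ([:: finish], s)).
  by rewrite (main_test Rs) hr.
have -> : P = neval s (cell (rcode RND) (NConst 0)) by rewrite (neval_cell _ _ Rs) /= muln0 !addn0.
by [].
Qed.

Lemma main_exit s m (t : seq R) : rep P s [:: n; nv; n] m -> (D <= size t)%N ->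
  exists s', foldl (@step R) (loop s) t = ([::], s') /\
    forall e, (e < n)%N -> nmem s' e = nar m SEL e.
Proof.
move=> Rs ht; have [k [s' [hk S Hs]]] := finishP Rs.
exists s'; split=> //; rewrite /loop.
have S0 : steps main_loop s 1 s.
  by apply: steps_while_false; rewrite (main_test Rs) ltnn.
rewrite (steps_foldl _ S0) ?(steps_foldl _ S) ?size_drop; try by rewrite /D in hk ht *; lia.
(* A halted configuration is a fixed point of [step], so the rest of the tape changes nothing. *)
by elim: (drop k _).
Qed.

Lemma main_halts j : forall s r m (t : seq R), (r + j = n)%N ->
  rep P s [:: n; nv; r] m -> data m -> mgood m -> (j * K + D <= size t)%N ->
  exists s' m', [/\ foldl (@step R) (loop s) t = ([::], s'), mgood m',
    forall e, (e < n)%N -> nmem s' e = nar m' SEL e &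
    forall e, (e < n)%N -> nar m SEL e != 0%N -> nar m' SEL e != 0%N].
Proof.
elim: j => [|j IH] s r m t hr Rs dm gm ht.
  rewrite addn0 in hr; rewrite hr in Rs.
  by have [s' [h1 h2]] := main_exit Rs ht; exists s', m.
have hrn : (r < n)%N by lia.
case: t ht => [|u0 [|u1 [|u t]]] ht; try by rewrite /K /= in ht; lia.
have {}ht : (K + (j * K + D) <= (size t).+3)%N by rewrite addnA -mulSn.
have [k [s1 [hk S1 R1]]] := main_roundP u hrn Rs.
have [p [_ _ _ _ /(_ u) [d1 h1 _]]] := roundP P_big r x01 dm gm.
set m1 := den _ _ _ _ in d1 h1 R1.
have g1 : mgood m1.
  case: h1 => [h1|[e ae h1]]; first exact: unchanged_good gm h1.
  exact: (accepted_good x01 gm ae h1).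
have [||s' [m' [e1 e2 e3 e4]]] := IH s1 r.+1 m1 (drop k t) _ R1 d1 g1.
- lia.
- by rewrite size_drop; lia.
exists s', m'; split=> // [|e he se].
  rewrite -[LHS]/(foldl (@step R) (loop s) [:: u0, u1, u & t]) (main_step _ _ _ _ hrn Rs).
  by rewrite (steps_foldl _ S1) //; lia.
apply: e4 => //; case: h1 => [[h1 _ _]|[e' _ [h1 _ _]]]; first by rewrite h1.
by rewrite h1 // /asel; case: ifP.
Qed.

(** Each selection lowers this number by one, so n rounds are enough when every round selects an
    edge. *)
Definition unselected m := (\sum_(0 <= e < n) (nar m SEL e == 0%N))%N.

Lemma unselected_accept m m' e : act_of n nv inc m e ->
  accepted n nv inc x m m' e -> unselected m = (unselected m').+1.
Proof.
case/and3P => he /eqP se _ [h _ _]; rewrite /unselected.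
rewrite (bigD1_seq e) ?mem_index_iota ?iota_uniq //= se eqxx add1n; congr _.+1.
rewrite [RHS](bigD1_seq e) ?mem_index_iota ?iota_uniq //= h // /asel eqxx add0n.
rewrite big_seq_cond [RHS]big_seq_cond; apply: eq_bigr => i.
by rewrite mem_index_iota => /andP[/andP[_ hi] ie]; rewrite h // /asel (negbTE ie).
Qed.

Lemma unselected_gt0 m e : (e < n)%N -> nar m SEL e = 0%N -> (0 < unselected m)%N.
Proof.
move=> he se; rewrite /unselected (bigD1_seq e) ?mem_index_iota ?iota_uniq //=.
by rewrite se eqxx.
Qed.

Section Target.
Variable f : nat.
Hypothesis fn : (f < n)%N.

Definition chosen : set (config R) := [set c | nmem c.2 f != 0%N].

(** Induction on the rounds left. Given that the draw picks e, the induction hypothesis bounds the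
    chance of f by its new potential; averaging over e and using that the potential does not
    decrease in expectation gives the old one. *)
Lemma main_prob j : forall s r m N, (r + j = n)%N -> rep P s [:: n; nv; r] m ->
  data m -> mgood m -> (unselected m <= j)%N -> (j * K + D <= N)%N ->
  ((mpotential n nv inc x f m / gap nv inc x f)%:E <=
   prob_tape N [set t | chosen (foldl (@step R) (loop s) t)])%E.
Proof.
have gap0 : 0 <= gap nv inc x f.
  have /andP[f0 f1] := x01 fn; rewrite /gap addr_ge0 // sumr_ge0 // => v _.
  by case: ifP => // _; rewrite subr_ge0.
elim: j => [|j IH] s r m N hr Rs dm gm um hN.
all: rewrite {1}/mpotential /potential; case: ifP => [sf|/negbFE/eqP sf].
1,3: rewrite prob_tape_all => [|t ht].
(* The gap is 0 when f is empty and x_f = 0; the quotient is then 0 by convention. *)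
1,3: by rewrite lee_fin; have [->|nz] := eqVneq (gap nv inc x f) 0;
  [rewrite invr0 mulr0|rewrite divff].
1,2: have := main_halts (t := t) hr Rs dm gm; rewrite ht => /(_ hN) [s' [m' [e1 _ h1 h2]]];
  change (chosen (foldl (@step R) (loop s) t)); rewrite e1 /chosen /= h1 //; exact: h2.
  by have := unselected_gt0 fn sf; rewrite ltnNge um.
case: ifP => [af|_]; last by rewrite mul0r prob_tape_ge0.
have hrn : (r < n)%N by lia.
have [N' [-> hN']] : exists N', N = N'.+3 /\ (K + (j * K + D) <= N' + 3)%N.
  exists (N - 3)%N; rewrite mulSn in hN; rewrite /K in hN *; lia.
have [p [p0 pa pf pS hp]] := roundP P_big r x01 dm gm.
pose cum i := \sum_(0 <= e < i) p e.
have S0 : 0 < cum n by exact: pS af.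
pose psi e := potential n nv inc x f (acap inc (nar m CAP) e)
  (amul inc x (nar m CAP) (rar m MUL) e) (asel (nar m SEL) e).
pose y e := if act_of n nv inc m e then psi e / gap nv inc x f else 0.
pose G u t := foldl (@step R) ([:: Seq (compile 3 round)
      (SetN (ctr 2) (NAdd (NLoad (ctr 2)) (NConst 1))); main_loop; finish],
    State (nmem s) (update (rmem s) P u)) t.
pose F u := prob_tape N' [set t | chosen (G u t)].
have -> : prob_tape N'.+3 [set t | chosen (foldl (@step R) (loop s) t)] =
    (\int[lebesgue_measure]_(u in `[0%R, 1%R]) F u)%E.
  rewrite (prob_tape_skip (Y' := [set t | chosen (G (head 0 (behead t)) (behead (behead t)))])).
    by rewrite (prob_tape_skip (Y' := [set t | chosen (G (head 0 t) (behead t))])).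
  move=> u0 [|u1 [|u t]] // _; rewrite /mkset.
  by rewrite (main_step _ _ _ _ hrn Rs).
have cum_le i i' : (i <= i')%N -> cum i <= cum i'.
  by move=> h; rewrite /cum (big_cat_nat (n := i) (p := i')) //= lerDl sumr_ge0.
have hF e u : (e < n)%N -> cum e / cum n < u <= cum e.+1 / cum n -> ((y e)%:E <= F u)%E.
  move=> he; rewrite ltr_pdivrMr // ler_pdivlMr // => hu.
  rewrite /y; case: ifP => ae; last exact: prob_tape_ge0.
  have [k [s1 [hk S1 R1]]] := main_roundP u hrn Rs.
  have [d1 _ /(_ e ae hu) h1] := hp u.
  set m1 := den _ _ _ _ in d1 h1 R1.
  have kN : (k <= N')%N by lia.
  rewrite /F /G (prob_tape_steps _ chosen S1) //.
  have -> : psi e = mpotential n nv inc x f m1.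
    by case: h1 => h1 h2 h3; apply/esym; apply: potential_eq.
  apply: (IH s1 r.+1) => //.
  - lia.
  - exact: (accepted_good x01 gm ae h1).
  - by rewrite -ltnS -(unselected_accept ae h1).
  - lia.
have y0 e : 0 <= y e.
  by rewrite /y; case: ifP => // _; rewrite divr_ge0 // potential_ge0.
have := @integral01_ge_step R F (fun e => cum e / cum n) y n.
move=> /(_ (fun u => prob_tape_ge0 _ _) y0) H.
apply: le_trans (H _ _ _ hF) => {H}.
- rewrite lee_fin.
  have [g0|nz] := eqVneq (gap nv inc x f) 0.
    rewrite g0 invr0 mulr0 sumr_ge0 // => e _; rewrite mulr_ge0 // subr_ge0.
    by rewrite ler_pM2r ?invr_gt0 // cum_le.
  have gp : 0 < gap nv inc x f by rewrite lt_neqAle eq_sym nz.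
  rewrite ler_pdivrMr // mulr_suml.
  (* The interval of e has length p_e / [cum n], so the step function integrates to the expected new
     potential over the gap. *)
  have := potential_step x01 fn gm af p0 pa (pf f fn).
  rewrite -ler_pdivlMr // mulr_suml {1}/potential sf af /= => /le_trans; apply.
  rewrite le_eqVlt; apply/orP; left; apply/eqP; apply: eq_bigr => e _.
  have pe : cum e.+1 = cum e + p e by rewrite /cum big_nat_recr.
  rewrite pe /y; case: ifP => ae; last by rewrite pa ?ae // !mul0r.
  rewrite /psi -/(cum n); field.
  by rewrite nz gt_eqF.
- by rewrite /cum big_geq // mul0r.
- by move=> i i' h; rewrite ler_pM2r ?invr_gt0 // cum_le.
- by rewrite divff // gt_eqF.
Qed.

End Target.

Hypothesis xb : forall v, (v < nv)%N ->
  \sum_(0 <= e < n) (if inc v e then x e else 0) <= (b v)%:R.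
Hypothesis b_gt0 : forall v, (v < nv)%N -> (0 < b v)%N.

Definition encodes s :=
  [/\ nmem s 0%N = nv /\ nmem s 1%N = n,
      forall v e, (v < nv)%N -> (e < n)%N -> nmem s (2 + (v * n + e))%N = inc v e,
      forall v, (v < nv)%N -> nmem s (2 + (nv * n + v))%N = b v,
      forall j, (2 + (nv * n + nv) <= j)%N -> nmem s j = 0%N
    & forall e, (e < n)%N -> rmem s e = x e].

Lemma steps_seq_foldl c1 c2 s k s' l (t : seq R) : steps c1 s k s' ->
  (k < size t)%N -> foldl (@step R) (Seq c1 c2 :: l, s) t =
  foldl (@step R) (c2 :: l, s') (drop k.+1 t).
Proof.
move=> H; case: t => [//|u t] ht.
by rewrite -[LHS]/(foldl (@step R) (c1 :: c2 :: l, s) t) (steps_foldl _ H).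
Qed.

Let start_time := (2 * P + 2 * nv + cost P setup + 25)%N.

Lemma algorithm_start s : encodes s -> exists k s' m,
  (k <= start_time)%N /\
  [/\ forall t, (k <= size t)%N ->
        foldl (@step R) ([:: algorithm], s) t = foldl (@step R) (loop s') (drop k t),
      rep P s' [:: n; nv; 0%N] m, data m, mgood m &
      forall f, (f < n)%N -> mpotential n nv inc x f m = x f].
Proof.
move=> [[h0 h1] hi hb hz hx].
have [k1 [s1 [m1 [hk1 [S1 R1 L1 N1 X1]]]]] := preludeP h0 h1 hz.
have vP : all (leq^~ P) [:: n; nv] by rewrite /= /P; lia.
have [k2 [s2 [hk2 S2 R2]]] := compileP P_gt0 setup R1 vP.
set m2 := den _ _ _ _ in R2.
have lowP v e : (v < nv)%N -> (e < n)%N -> (2 + (v * n + e) < P)%N.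
  by move=> hv he; exact: (idx_lt P_big).
have [d2 E2 C2 M2] : [/\ data m2, forall e, nar m2 SEL e = 0%N,
      forall v, (v < nv)%N -> nar m2 CAP v = b v
    & forall v, (v < nv)%N -> rar m2 MUL v = 1].
  apply: (setupP P_big) => //.
  - by move=> v e hv he; rewrite L1 ?hi // lowP.
  - by move=> e he; rewrite X1 // hx.
  - by move=> v hv; rewrite L1 ?hb // /P; lia.
have R3 := rep_ctr P_gt0 0%N R2; rewrite -[rcons _ _]/[:: n; nv; 0%N] in R3.
set s3 := State _ _ in R3.
have S3 : steps (SetN (ctr 2) (NConst 0)) s2 1 s3.
  apply: steps1 => l u.
  rewrite -[LHS]/(l, State (update (nmem s2) (neval s2 (ctr 2)) 0%N) (rmem s2)).
  by rewrite (neval_ctr _ R2).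
(* One step for each of the four outer [Seq] and one for resetting the round counter. *)
exists (k1.+1 + k2.+1 + 3)%N, s3, m2; split; first by rewrite /start_time; lia.
split=> //.
- move=> t ht; rewrite /algorithm (steps_seq_foldl _ _ S1); last by lia.
  rewrite (steps_seq_foldl _ _ S2) ?size_drop; last by lia.
  rewrite (steps_seq_foldl _ _ S3) ?size_drop; last by lia.
  rewrite !drop_drop; set i := (X in foldl _ _ (drop X t) = _).
  have -> : (k1.+1 + k2.+1 + 3 = 1 + i)%N by rewrite /i; lia.
  rewrite -drop_drop; have : (0 < size (drop i t))%N by rewrite size_drop /i; lia.
  by case: (drop i t) => [//|u d] _; rewrite drop1.
- split=> [e he|v hv|v hv|v hv|v hv].
  + by rewrite E2.
  + by rewrite C2 // big1 ?addn0 // => e _; rewrite E2 muln0.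
  + by rewrite M2 // lexx ler01.
  + by rewrite C2 // => b0; have := b_gt0 hv; rewrite b0.
  + rewrite C2 //; apply: le_trans (xb hv); rewrite le_eqVlt; apply/orP; left.
    by apply/eqP; apply: eq_bigr => e _; rewrite /load E2 eqxx andbT M2 // mulr1.
- move=> f hf; rewrite /mpotential /potential E2 /=.
  have -> : active n nv inc (nar m2 CAP) (nar m2 SEL) f.
    apply/and3P; split; rewrite ?E2 //; apply/allP => v; rewrite mem_iota => hv.
    by apply/implyP => _; rewrite C2 // b_gt0.
  have -> : deficit nv inc f (rar m2 MUL) = 0.
    by rewrite /deficit big_nat big1 // => v hv; rewrite M2 // subrr if_same.
  by rewrite mulr0 subr0 max_r //; have /andP[] := x01 hf.
Qed.

Definition run_time := (start_time + n * K + D)%N.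

Lemma algorithm_halts s (t : seq R) : encodes s -> (run_time <= size t)%N ->
  exists s' m', [/\ foldl (@step R) ([:: algorithm], s) t = ([::], s'), mgood m'
    & forall e, (e < n)%N -> nmem s' e = nar m' SEL e].
Proof.
move=> es ht; have [k [s' [m [hk [S Rs dm gm _]]]]] := algorithm_start es.
rewrite S; last by rewrite /run_time in ht; lia.
have [|s2 [m2 [E g h _]]] := main_halts (t := drop k t) (add0n n) Rs dm gm.
  by rewrite size_drop /run_time in ht *; lia.
by exists s2, m2.
Qed.

Lemma unselected_le m : (unselected m <= n)%N.
Proof.
rewrite /unselected -[X in (_ <= X)%N](card_ord n) -sum1_card big_mkord.
by apply: leq_sum => e _; case: eqP.
Qed.

Lemma algorithm_prob s f N : encodes s -> (f < n)%N -> (run_time <= N)%N ->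
  ((x f / gap nv inc x f)%:E <=
   prob_tape N [set t | chosen f (foldl (@step R) ([:: algorithm], s) t)])%E.
Proof.
move=> es hf hN; have [k [s' [m [hk [S Rs dm gm <-]]]]] // := algorithm_start es.
have kN : (k <= N)%N by rewrite /run_time in hN; lia.
have -> : prob_tape N [set t | chosen f (foldl (@step R) ([:: algorithm], s) t)] =
    prob_tape (N - k) [set t | chosen f (foldl (@step R) (loop s') t)].
  rewrite -[RHS](prob_tape_drop k) subnKC //; apply: eq_prob_tape => t ht.
  by rewrite /= S // ht.
apply: (main_prob hf (add0n n) Rs dm gm (unselected_le m)).
by rewrite /run_time in hN; lia.
Qed.

End Machine.

(** * Running time and input encoding *)

Definition poly_bounded (g : nat -> nat) :=
  exists C k, forall P, (g P <= C * P.+1 ^ k)%N.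

Lemma poly_bounded_const c : poly_bounded (fun=> c).
Proof. by exists c, 0%N => P; rewrite expn0 muln1. Qed.

Lemma poly_bounded_id : poly_bounded id.
Proof. by exists 1%N, 1%N => P; rewrite expn1; lia. Qed.

Lemma poly_bounded_add g h :
  poly_bounded g -> poly_bounded h -> poly_bounded (fun P => g P + h P)%N.
Proof.
move=> [C [k hg]] [C' [k' hh]]; exists (C + C')%N, (k + k')%N => P.
rewrite mulnDl leq_add //.
  by apply: leq_trans (hg P) _; rewrite leq_mul // leq_pexp2l // leq_addr.
by apply: leq_trans (hh P) _; rewrite leq_mul // leq_pexp2l // leq_addl.
Qed.

Lemma poly_bounded_mul g h :
  poly_bounded g -> poly_bounded h -> poly_bounded (fun P => g P * h P)%N.
Proof.
move=> [C [k hg]] [C' [k' hh]]; exists (C * C')%N, (k + k')%N => P.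
by rewrite expnD mulnACA leq_mul.
Qed.

Lemma poly_bounded_cost p : poly_bounded (cost^~ p).
Proof.
elim: p => [|a i e|a i e|i e|p1 IH1 p2 IH2|c p1 IH1 p2 IH2|k p IH] /=;
  try exact: poly_bounded_const.
- exact: poly_bounded_add (poly_bounded_add (poly_bounded_const 1) IH1) IH2.
- exact: poly_bounded_add (poly_bounded_add (poly_bounded_const 1) IH1) IH2.
- apply: poly_bounded_add (poly_bounded_const 3); apply: poly_bounded_mul poly_bounded_id _.
  exact: poly_bounded_add IH (poly_bounded_const 3).
Qed.

Lemma run_time_poly : exists q : {poly nat}, forall n nv, (run_time n nv <= q.[nv + n])%N.
Proof.
have [C [k h]] : poly_bounded (fun P => 2 * P + 2 * P + cost P setup + 25 +
    P * (cost P round + 6) + (cost P copyout + 4))%N.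
  have [B0 B1] := (poly_bounded_const, poly_bounded_id).
  apply: poly_bounded_add; last exact: poly_bounded_add (poly_bounded_cost _) (B0 4).
  apply: poly_bounded_add; last first.
    by apply: poly_bounded_mul B1 _; exact: poly_bounded_add (poly_bounded_cost _) (B0 6).
  apply: poly_bounded_add (B0 25); apply: poly_bounded_add (poly_bounded_cost _).
  by apply: poly_bounded_add; exact: poly_bounded_mul (B0 2) B1.
(* The time is polynomial in P, and P + 1 <= (nv + n + 5)^2, which doubles the exponent. *)
exists (C%:P * ('X + 5%:P) ^+ (2 * k)) => n nv.
rewrite hornerM hornerC horner_exp hornerD hornerX hornerC.
rewrite -[X in (_ <= X)%N]/(C * _)%N.
set P := (nv * n + (nv + (n + n + 4)))%N.
apply: (@leq_trans (C * P.+1 ^ k)).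
  apply: leq_trans (h P); rewrite /run_time -/P.
  have nP : (n <= P)%N by rewrite /P; lia.
  have vP : (nv <= P)%N by rewrite /P; lia.
  have : (n * (cost P round + 6) <= P * (cost P round + 6))%N by rewrite leq_mul2r nP orbT.
  lia.
apply: leq_mul => //; rewrite -[X in (_ <= X)%N]/((nv + n + 5) ^ (2 * k))%N.
have [->|k0] := posnP k; first by rewrite muln0 !expn0.
by rewrite expnM leq_exp2r // /P -mulnn !mulnDl !mulnDr; lia.
Qed.

Lemma nth_allpairs (S T U : Type) (g : S -> T -> U) (s : seq S) (t : seq T) x0 y0 z0 i j :
  (i < size s)%N -> (j < size t)%N ->
  nth z0 [seq g y z | y <- s, z <- t] (i * size t + j) = g (nth x0 s i) (nth y0 t j).
Proof.
elim: s i => [//|y s IH] [|i] hi hj; rewrite allpairs_cons nth_cat size_map.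
  by rewrite mul0n hj (nth_map y0).
rewrite mulSn -addnA ltnNge leq_addr /= addKn; exact: IH.
Qed.

(** * From the hypergraph to the encoded memory and back *)

Section Input.
Variables (R : realType) (V : finType) (E : {set {set V}}) (b : V -> nat).
Variables (w x : {set V} -> R).
Hypothesis b1 : forall v, (1 <= b v)%N.
Hypothesis xE : is_fractional_bmatching E b x.

Let n := #|E|.
Let nv := #|V|.
Let s0 := encode E b w x.
(** The numeric instance is read off the encoded memory, which makes it total on [nat] without
    default vertices or edges. *)
Definition ninc (v e : nat) : bool := nmem s0 (2 + (v * n + e))%N != 0%N.
Definition nx (e : nat) : R := rmem s0 e.
Definition nb (v : nat) : nat := nmem s0 (2 + (nv * n + v))%N.

Lemma nmem_inc (v : V) e : e \in E ->
  nmem s0 (2 + (index v (enum V) * n + index e (enum E)))%N = (v \in e).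
Proof.
move=> he; rewrite /s0 /encode /= nth_cat size_allpairs -!cardE -/n -/nv.
have iv : (index v (enum V) < nv)%N by rewrite /nv cardE index_mem mem_enum.
have ie : (index e (enum E) < n)%N by rewrite /n cardE index_mem mem_enum.
have -> : (index v (enum V) * n + index e (enum E) < nv * n)%N.
  have : ((index v (enum V)).+1 * n <= nv * n)%N by rewrite leq_mul2r iv orbT.
  by rewrite mulSn; lia.
rewrite {1}/n cardE (nth_allpairs _ v e) -?cardE //.
by rewrite !nth_index ?mem_enum.
Qed.

Lemma nmem_b (v : V) : nb (index v (enum V)) = b v.
Proof.
rewrite /nb /s0 /encode /= nth_cat size_allpairs -!cardE -/n -/nv add0n ltnNge leq_addr /= addKn.
have iv : (index v (enum V) < size (enum V))%N by rewrite index_mem mem_enum.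
by rewrite (nth_map v) // nth_index ?mem_enum.
Qed.

Lemma rmem_x e : e \in E -> nx (index e (enum E)) = x e.
Proof.
move=> he; have ie : (index e (enum E) < size (enum E))%N by rewrite index_mem mem_enum.
rewrite /nx /s0 /encode /= nth_cat size_map ie (nth_map e) // nth_index ?mem_enum //.
Qed.

Lemma ex_vertex v : (v < nv)%N -> exists u, v = index u (enum V).
Proof.
rewrite /nv cardE => hv; have [u _] : exists u : V, true.
  by case: (enum V) hv => // u; exists u.
by exists (nth u (enum V) v); rewrite index_uniq // enum_uniq.
Qed.

Lemma ex_edge e : (e < n)%N -> exists2 e', e' \in E & e = index e' (enum E).
Proof.
rewrite /n cardE => he; exists (nth finset.set0 (enum E) e).
  by rewrite -mem_enum mem_nth.
by rewrite index_uniq // enum_uniq.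
Qed.

Lemma ninc_index (v : V) e : e \in E ->
  ninc (index v (enum V)) (index e (enum E)) = (v \in e).
Proof. by move=> he; rewrite /ninc nmem_inc //; case: (v \in e). Qed.

Lemma encodes_encode : encodes n nv ninc nx nb s0.
Proof.
split=> //.
- move=> v e /ex_vertex [u ->] /ex_edge [e' he ->].
  by rewrite ninc_index // nmem_inc.
- move=> j hj; rewrite /s0 /encode /= nth_default //=.
  rewrite size_cat size_allpairs size_map -!cardE -/n -/nv; lia.
Qed.

Lemma sum_edges (U : nmodType) (F : {set V} -> U) (G : nat -> U) :
  (forall e, e \in E -> G (index e (enum E)) = F e) ->
  \sum_(0 <= e < n) G e = \sum_(e in E) F e.
Proof.
move=> h; rewrite -big_enum /= (big_nth finset.set0) -cardE -/n.
rewrite !big_nat; apply: eq_bigr => i hi; rewrite -h.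
  by rewrite index_uniq ?enum_uniq // -cardE.
by rewrite -mem_enum mem_nth // -cardE.
Qed.

Lemma sum_vertices (U : nmodType) (F : V -> U) (G : nat -> U) :
  (forall v, G (index v (enum V)) = F v) ->
  \sum_(0 <= v < nv) G v = \sum_v F v.
Proof.
move=> h; rewrite -big_enum /= big_nat.
have [v0 _|V0] := pickP (fun _ : V => true); last first.
  rewrite (_ : enum V = [::]) ?big_nil; last first.
    by case: (enum V) => // v s; have := V0 v.
  have -> : nv = 0%N by rewrite /nv; apply: eq_card0 => v; have := V0 v.
  by rewrite -big_nat big_geq.
rewrite (big_nth v0) -cardE -/nv [RHS]big_nat; apply: eq_bigr => i hi.
by rewrite -h index_uniq ?enum_uniq // -cardE.
Qed.

Lemma nx01 e : (e < n)%N -> 0 <= nx e <= 1.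
Proof. by move=> /ex_edge [e' he ->]; rewrite rmem_x //; case: xE => h _; exact: h. Qed.

Lemma nb_gt0 v : (v < nv)%N -> (0 < nb v)%N.
Proof. by move=> /ex_vertex [u ->]; rewrite nmem_b. Qed.

Lemma nx_load v : (v < nv)%N ->
  \sum_(0 <= e < n) (if ninc v e then nx e else 0) <= (nb v)%:R.
Proof.
move=> /ex_vertex [u ->]; rewrite nmem_b.
rewrite (sum_edges (F := fun e => if u \in e then x e else 0)) => [|e he].
  case: xE => _ /(_ u); congr (_ <= _).
  by rewrite -big_mkcondr; apply: eq_bigl => e; rewrite inE.
by rewrite ninc_index // rmem_x.
Qed.

(** Used plus remaining capacity equals b_v, and the remaining part is a natural number. *)
Lemma output_bmatching (c : config R) (m : memory R) :
  mgood n nv ninc nx nb m -> (forall e, (e < n)%N -> nmem c.2 e = nar m SEL e) ->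
  is_bmatching E b (output E c).
Proof.
move=> [h1 h2 _ _ _] hc; split.
  by apply/fintype.subsetP => e; rewrite inE => /andP[].
move=> v; have iv : (index v (enum V) < nv)%N by rewrite /nv cardE index_mem mem_enum.
rewrite -nmem_b -(h2 _ iv); apply: (@leq_trans
  (\sum_(0 <= e < n) ninc (index v (enum V)) e * nar m SEL e)%N); last by rewrite leq_addl.
have -> : (\sum_(0 <= e < n) ninc (index v (enum V)) e * nar m SEL e =
    \sum_(e in E) (v \in e) * nar m SEL (index e (enum E)))%N.
  by apply: (sum_edges (U := nat)) => e he; rewrite ninc_index.
rewrite -sum1_card big_mkcond [X in (_ <= X)%N]big_mkcond; apply: leq_sum => e _.
rewrite !inE; case: (boolP (e \in E)) => //= he.
case: (v \in e); rewrite ?andbF // andbT mul1n -hc; first by case: (nmem _ _).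
by rewrite /n cardE index_mem mem_enum.
Qed.

Lemma gap_index e : e \in E ->
  gap nv ninc nx (index e (enum E)) = #|e|%:R - (#|e|%:R - 1) * x e.
Proof.
move=> he; rewrite /gap (sum_vertices (F := fun v => if v \in e then 1 - x e else 0)).
  by rewrite -big_mkcond sumr_const rmem_x // -[(1 - x e) *+ _]mulr_natl; ring.
by move=> v; rewrite ninc_index // rmem_x.
Qed.

Lemma output_chosen e (c : config R) : e \in E ->
  (e \in output E c) = (nmem c.2 (index e (enum E)) != 0%N).
Proof. by move=> he; rewrite inE he. Qed.

End Input.

Theorem theorem3 (R : realType) :
  exists (A : cmd) (q : {poly nat}),
    forall (V : finType) (E : {set {set V}}) (b : V -> nat)
           (w x : {set V} -> R),
      (forall v : V, (1 <= b v)%N) ->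
      (forall e, e \in E -> 0 <= w e) ->
      is_fractional_bmatching E b x ->
      let T : nat := q.[(#|V| + #|E|)%N] in
      let final (t : T.-tuple R) := run A (encode E b w x) t in
      (forall t : T.-tuple R, (forall i : 'I_T, 0 <= tnth t i <= 1) ->
         halted (final t) /\ is_bmatching E b (output E (final t))) /\
      (forall e, e \in E ->
         ((x e / (#|e|%:R - (#|e|%:R - 1) * x e))%:E
            <= tape_prob [set t | e \in output E (final t)])%E).
Proof.
have [q hq] := run_time_poly.
exists algorithm, q => V E b w x b1 _ xE T final.
have hT : (run_time #|E| #|V| <= T)%N by exact: hq.
have es := encodes_encode E b w x.
split=> [t _|e he].
  have ht : (run_time #|E| #|V| <= size t)%N by rewrite size_tuple.
  have [s [m [Ef gm hs]]] := algorithm_halts (nx01 w xE) (nx_load w xE) (nb_gt0 E w x b1) es ht.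
  have -> : final t = ([::], s) by exact: Ef.
  by split=> //; exact: (output_bmatching (w := w) (x := x) gm).
have fn : (index e (enum E) < #|E|)%N by rewrite cardE index_mem mem_enum.
have := algorithm_prob (nx01 w xE) (nx_load w xE) (nb_gt0 E w x b1) es fn hT.
rewrite gap_index // rmem_x // => /le_trans; apply.
rewrite le_eqVlt; apply/orP; left; apply/eqP.
by congr tape_prob; apply/funext => t; apply/propext; rewrite /mkset output_chosen.
Qed.
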